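(* Suppose $f=\frac1n\sum_{i=1}^n f_i$ is $\mu$-strongly convex and each $f_i$ has $L$-Lipschitz continuous gradient. Let $n_c\ge1$ and $1\le n_g<\infty$, and let $r_k$ be the error vectors of the gradient tracking algorithm described in the context with step size $\alpha>0$. If the matrix $B(n_c,n_g)$ defined in the context is irreducible, $\beta_1,\beta_3<1$ and $$\alpha<\min\left\{\frac{1}{n_gL},\ \frac{\mu}{(2L^2+\mu^2)(n_g-1)},\ \frac{1}{2L}\sqrt{\frac{3(1-\beta_1^{n_c})}{\delta_1(n_c,n_g)(n_g-1)}},\ \frac{3(1-\beta_3^{n_c})}{4L(\beta_4^{n_c}+\delta_2(n_c,n_g)(n_g-1))},\ \frac{-b_2+\sqrt{b_2^2+4b_1b_3}}{2b_1}\right\},$$ where, writing $\delta_1=\delta_1(n_c,n_g)$ and $\delta_2=\delta_2(n_c,n_g)$, $$\begin{aligned}b_1=&\ \tfrac{\mu L^2n_g}{2}\left[(n_g-1)(\beta_1^{n_c}+\delta_1)+\beta_2^{n_c}\right]\left[\beta_4^{n_c}+(n_g-1)\delta_2\right]\\&+L^3n_g(n_g-1)\left[\delta_1\left(\tfrac{1-\beta_3^{n_c}}{4}\right)+(\beta_4^{n_c}+(n_g-1)\delta_2)\left(\tfrac{1-\beta_1^{n_c}}{4}\right)\right]\\&+L^2(n_g-1)^2\left[L\delta_1\left(3\beta_4^{n_c}+(n_g-1)\delta_2\right)+\delta_1\left(\tfrac{1-\beta_3^{n_c}}{4}\right)\right]\\&+L^2\left[\beta_4^{n_c}+(n_g-1)\delta_2\right]\left[Ln_g+(n_g-1)\right]\left[(n_g-1)(\beta_1^{n_c}+\delta_1)+\beta_2^{n_c}\right],\\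 b_2=&\ \mu n_g\beta_4^{n_c}L\left((n_g-1)(\beta_1^{n_c}+\delta_1)+\beta_2^{n_c}\right),\qquad b_3=\tfrac{\mu n_g}{2}\left(\tfrac{1-\beta_1^{n_c}}{4}\right)\left(\tfrac{1-\beta_3^{n_c}}{4}\right),\end{aligned}$$ then $\rho(B(n_c,n_g))<1$, and for all $\epsilon>0$ there exists a constant $C_\epsilon>0$ such that, for all $k\ge0$, $$\|r_k\|_2\le C_\epsilon\left(\rho(B(n_c,n_g))+\epsilon\right)^k\|r_0\|_2.$$
   Context: Functions: $f_i:\mathbb{R}^d\to\mathbb{R}$, $i=1,\dots,n$, are differentiable. $\mu$-strong convexity ($\mu>0$): $f(z')\ge f(z)+\langle\nabla f(z),z'-z\rangle+\frac{\mu}{2}\|z'-z\|_2^2$ for all $z,z'\in\mathbb{R}^d$. $L$-Lipschitz gradients: $\|\nabla f_i(z)-\nabla f_i(z')\|_2\le L\|z-z'\|_2$ for all $z,z'$ and all $i$. $x^*$ is the unique minimizer of $f$; $\kappa=L/\mu$; $\rho(\cdot)$ denotes spectral radius. Convention: in the minimum bounding $\alpha$, terms whose denominator is zero (e.g. those with factor $n_g-1$ when $n_g=1$) are read as $+\infty$. Communication matrices: the $n$ nodes form a connected undirected network with edge set $\mathcal{E}$. A communication matrix $\mathbf{U}\in\mathbb{R}^{n\times n}$ is symmetric, doubly stochastic, with $u_{ii}>0$, $u_{ij}\ge0$ for $i\ne j$, $(i,j)\in\mathcal{E}$, and $u_{ij}=0$ for $i\ne j$, $(i,j)\notin\mathcal{E}$.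 $\mathbf{W}_1,\dots,\mathbf{W}_4$ are communication matrices, $\mathbf{Z}_i=\mathbf{W}_i\otimes I_d$, $\beta_i=\|\mathbf{W}_i-\frac{1_n1_n^T}{n}\|_2\in[0,1]$, so $\beta_i^{n_c}=\|\mathbf{W}_i^{n_c}-\frac{1_n1_n^T}{n}\|_2$. Algorithm ($n_c$ communication steps and $n_g$ computation steps per outer iteration): for $\mathbf{x}=(x_1,\dots,x_n)\in\mathbb{R}^{nd}$ write $\nabla\mathbf{f}(\mathbf{x})=(\nabla f_1(x_1),\dots,\nabla f_n(x_n))$. Given arbitrary $\mathbf{x}_{0,1}\in\mathbb{R}^{nd}$, $\mathbf{y}_{0,1}=\nabla\mathbf{f}(\mathbf{x}_{0,1})$. For $k\ge0$: for $j=1,\dots,n_g-1$, $\mathbf{x}_{k,j+1}=\mathbf{x}_{k,j}-\alpha\mathbf{y}_{k,j}$ and $\mathbf{y}_{k,j+1}=\mathbf{y}_{k,j}+\nabla\mathbf{f}(\mathbf{x}_{k,j+1})-\nabla\mathbf{f}(\mathbf{x}_{k,j})$; then $\mathbf{x}_{k+1,1}=\mathbf{Z}_1^{n_c}\mathbf{x}_{k,n_g}-\alpha\mathbf{Z}_2^{n_c}\mathbf{y}_{k,n_g}$ and $\mathbf{y}_{k+1,1}=\mathbf{Z}_3^{n_c}\mathbf{y}_{k,n_g}+\mathbf{Z}_4^{n_c}(\nabla\mathbf{f}(\mathbf{x}_{k+1,1})-\nabla\mathbf{f}(\mathbf{x}_{k,n_g}))$. Error vector: $\bar x_{k,j}=\frac1n\sum_ix_{i,k,j}$,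 $\bar y_{k,j}=\frac1n\sum_iy_{i,k,j}$; $\bar{\mathbf{x}}_{k,j},\bar{\mathbf{y}}_{k,j}\in\mathbb{R}^{nd}$ are these averages repeated $n$ times; $r_k=\left(\|\bar x_{k,1}-x^*\|_2,\ \|\mathbf{x}_{k,1}-\bar{\mathbf{x}}_{k,1}\|_2,\ \|\mathbf{y}_{k,1}-\bar{\mathbf{y}}_{k,1}\|_2\right)^T$. Matrix $B$: $B(n_c,n_g)=A(n_c,n_g)+\alpha L(n_g-1)E(n_c,n_g)$ with $$A(n_c,n_g)=\begin{bmatrix}(1-\alpha\mu)^{n_g}&\frac{\kappa}{\sqrt n}(1-(1-\alpha\mu)^{n_g})&0\\0&\beta_1^{n_c}&\alpha((n_g-1)\beta_1^{n_c}+\beta_2^{n_c})\\ \sqrt n\alpha\beta_4^{n_c}L^2&\beta_4^{n_c}L(\|\mathbf{Z}_1^{n_c}-I_{nd}\|_2+\alpha L)&\beta_3^{n_c}+\alpha\beta_4^{n_c}L\end{bmatrix},$$ $$E(n_c,n_g)=\begin{bmatrix}\alpha Ln_g&\frac{\alpha Ln_g}{\sqrt n}&\frac{\alpha n_g}{\sqrt n}\\ \sqrt n\alpha L\delta_1&\alpha L\delta_1&\alpha\delta_1\\ \sqrt nL\delta_2&L\delta_2&\delta_2\end{bmatrix},$$ $\delta_1(n_c,n_g)=2\beta_2^{n_c}+\beta_1^{n_c}(n_g-2)$, $\ \delta_2(n_c,n_g)=2\left(\beta_4^{n_c}\|\mathbf{Z}_1^{n_c}-I_{nd}\|_2+\frac{\beta_4^{n_c}}{n_g}+\beta_3^{n_c}\right)$.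 *)

(* Defs.v *)
From HB Require Import structures.
From mathcomp Require Import all_boot all_order all_fingroup all_algebra.
From mathcomp Require Import all_classical all_reals all_analysis.
From mathcomp.real_closed Require Import complex mxtens.

Set Implicit Arguments.
Unset Strict Implicit.
Unset Printing Implicit Defensive.

Import Order.TTheory GRing.Theory Num.Theory.
Import numFieldNormedType.Exports.

Local Open Scope classical_set_scope.
Local Open Scope ring_scope.

Section LinearAlgebra.
Variable R : realType.

(* The norm [`|_|] carried by matrices in the library is the max norm, hence
   the Euclidean and the spectral norms below. *)
Definition l2norm m (v : 'cV[R]_m) : R := Num.sqrt (\sum_i v i 0 ^+ 2).

Definition dotprod m (u v : 'cV[R]_m) : R := \sum_i u i 0 * v i 0.

Definition op2norm m p (A : 'M[R]_(m, p)) : R :=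
  sup [set l2norm (A *m v) | v in [set v : 'cV[R]_p | l2norm v <= 1]].

Definition spectral_radius m (A : 'M[R]_m) : R :=
  sup [set complex.Re `|z| | z in [set z : R[i] |
                            eigenvalue (map_mx (real_complex R) A) z]].

(* A matrix is reducible when some simultaneous permutation of its rows and
   columns makes it block upper triangular, with square diagonal blocks of
   sizes [r] and [m - r], both nonzero. *)
Definition reducible_mx m (A : 'M[R]_m) : Prop :=
  exists (s : 'S_m) (r : nat), (0 < r < m)%N /\
    forall i j : 'I_m, (r <= i)%N -> (j < r)%N ->
      ((perm_mx s)^T *m A *m perm_mx s) i j = 0.

Definition irreducible_mx m (A : 'M[R]_m) : Prop := ~ reducible_mx A.

End LinearAlgebra.

Section Functions.
Variables (R : realType) (d : nat).
Implicit Type f : 'cV[R]_d -> R.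

Definition grad f (z : 'cV[R]_d) : 'cV[R]_d :=
  \col_j 'D_(delta_mx j 0) f z.

Definition strongly_convex (mu : R) f : Prop :=
  forall z z' : 'cV[R]_d,
    f z + dotprod (grad f z) (z' - z) + mu / 2 * l2norm (z' - z) ^+ 2 <= f z'.

Definition lipschitz_grad (L : R) f : Prop :=
  forall z z' : 'cV[R]_d, l2norm (grad f z - grad f z') <= L * l2norm (z - z').

Definition is_minimizer f (x : 'cV[R]_d) : Prop := forall z, f x <= f z.

Definition average n (fs : 'I_n -> 'cV[R]_d -> R) : 'cV[R]_d -> R :=
  fun z => n%:R^-1 * \sum_i fs i z.

End Functions.

Section Network.
Variables (R : realType) (n : nat).

Definition connected_network (e : rel 'I_n) : Prop :=
  symmetric e /\ forall i j, connect e i j.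

Definition communication_matrix (e : rel 'I_n) (U : 'M[R]_n) : Prop :=
  [/\ U^T = U,
      (forall i, \sum_j U i j = 1) /\ (forall j, \sum_i U i j = 1),
      forall i, 0 < U i i,
      forall i j, i != j -> e i j -> 0 <= U i j
    & forall i j, i != j -> ~~ e i j -> U i j = 0].

Definition beta (W : 'M[R]_n) : R := op2norm (W - n%:R^-1 *: const_mx 1).

End Network.

(* Vectors of R^(nd) are stacks of n blocks of size d; [mxtens_index (i, j)] is
   the position of the j-th coordinate of the i-th block, which is the ordering
   of the Kronecker product [*t]. *)
Section Stacking.
Variables (R : realType) (n d : nat).

Definition block (x : 'cV[R]_(n * d)) (i : 'I_n) : 'cV[R]_d :=
  \col_j x (mxtens_index (i, j)) 0.

Definition stack (v : 'I_n -> 'cV[R]_d) : 'cV[R]_(n * d) :=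
  \col_k v (mxtens_unindex k).1 (mxtens_unindex k).2 0.

Definition mean (x : 'cV[R]_(n * d)) : 'cV[R]_d :=
  n%:R^-1 *: \sum_i block x i.

Definition repmean (x : 'cV[R]_(n * d)) : 'cV[R]_(n * d) :=
  stack (fun _ => mean x).

Definition stacked_grad (fs : 'I_n -> 'cV[R]_d -> R) (x : 'cV[R]_(n * d)) :
    'cV[R]_(n * d) :=
  stack (fun i => grad (fs i) (block x i)).

End Stacking.

Definition kron_id (R : realType) (n d : nat) (W : 'M[R]_n) : 'M[R]_(n * d) :=
  W *t (1%:M : 'M[R]_d).

(* [x k j] and [y k j] are the iterates with indices k >= 0 and 1 <= j <= ng;
   values at other j are unconstrained, and [x 0 1] is arbitrary. *)
Definition gradient_tracking (R : realType) (n d nc ng : nat) (alpha : R)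
    (W1 W2 W3 W4 : 'M[R]_n) (fs : 'I_n -> 'cV[R]_d -> R)
    (x y : nat -> nat -> 'cV[R]_(n * d)) : Prop :=
  [/\ y 0%N 1%N = stacked_grad fs (x 0%N 1%N),
      forall k j, (1 <= j < ng)%N ->
        x k j.+1 = x k j - alpha *: y k j /\
        y k j.+1 = y k j + stacked_grad fs (x k j.+1) - stacked_grad fs (x k j),
      forall k, x k.+1 1%N =
        kron_id d W1 ^+ nc *m x k ng - alpha *: (kron_id d W2 ^+ nc *m y k ng)
    & forall k, y k.+1 1%N =
        kron_id d W3 ^+ nc *m y k ng
        + kron_id d W4 ^+ nc
          *m (stacked_grad fs (x k.+1 1%N) - stacked_grad fs (x k ng))].

Definition mx3 (R : realType) (s : seq (seq R)) : 'M[R]_3 :=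
  \matrix_(i, j) nth 0 (nth [::] s i) j.

Definition error_vector (R : realType) (n d : nat) (xs : 'cV[R]_d)
    (x y : nat -> nat -> 'cV[R]_(n * d)) (k : nat) : 'cV[R]_3 :=
  \col_i nth 0 [:: l2norm (mean (x k 1%N) - xs);
                   l2norm (x k 1%N - repmean (x k 1%N));
                   l2norm (y k 1%N - repmean (y k 1%N))] i.

Section Rate.
Variables (R : realType) (n d nc ng : nat) (alpha mu L : R).
Variables W1 W2 W3 W4 : 'M[R]_n.

Local Notation p1 := (beta W1 ^+ nc).
Local Notation p2 := (beta W2 ^+ nc).
Local Notation p3 := (beta W3 ^+ nc).
Local Notation p4 := (beta W4 ^+ nc).
Local Notation zeta := (op2norm (kron_id d W1 ^+ nc - 1%:M)).
Local Notation N := (n%:R : R).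
Local Notation G := (ng%:R : R).
Local Notation kappa := (L / mu).

(* [ng] is cast before subtracting: [G - 2] is negative for [ng = 1]. *)
Definition delta1 : R := 2 * p2 + p1 * (G - 2).
Definition delta2 : R := 2 * (p4 * zeta + p4 / G + p3).

Definition A_mx : 'M[R]_3 := mx3
  [:: [:: (1 - alpha * mu) ^+ ng;
          kappa / Num.sqrt N * (1 - (1 - alpha * mu) ^+ ng);
          0];
      [:: 0;
          p1;
          alpha * ((G - 1) * p1 + p2)];
      [:: Num.sqrt N * alpha * p4 * L ^+ 2;
          p4 * L * (zeta + alpha * L);
          p3 + alpha * p4 * L]].

Definition E_mx : 'M[R]_3 := mx3
  [:: [:: alpha * L * G;
          alpha * L * G / Num.sqrt N;
          alpha * G / Num.sqrt N];
      [:: Num.sqrt N * alpha * L * delta1;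
          alpha * L * delta1;
          alpha * delta1];
      [:: Num.sqrt N * L * delta2;
          L * delta2;
          delta2]].

Definition B_mx : 'M[R]_3 := A_mx + (alpha * L * (G - 1)) *: E_mx.

Definition b1 : R :=
  mu * L ^+ 2 * G / 2
    * ((G - 1) * (p1 + delta1) + p2) * (p4 + (G - 1) * delta2)
  + L ^+ 3 * G * (G - 1)
    * (delta1 * ((1 - p3) / 4) + (p4 + (G - 1) * delta2) * ((1 - p1) / 4))
  + L ^+ 2 * (G - 1) ^+ 2
    * (L * delta1 * (3 * p4 + (G - 1) * delta2) + delta1 * ((1 - p3) / 4))
  + L ^+ 2 * (p4 + (G - 1) * delta2) * (L * G + (G - 1))
    * ((G - 1) * (p1 + delta1) + p2).

Definition b2 : R := mu * G * p4 * L * ((G - 1) * (p1 + delta1) + p2).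

Definition b3 : R := mu * G / 2 * ((1 - p1) / 4) * ((1 - p3) / 4).

(* Fractions in the step size bound are read as +oo when their denominator
   vanishes. *)
Definition frac_oo (a b : R) : \bar R :=
  if b == 0 then +oo%E else (a / b)%:E.

Definition step_bound : \bar R :=
  (Order.min (frac_oo 1 (G * L))
  (Order.min (frac_oo mu ((2 * L ^+ 2 + mu ^+ 2) * (G - 1)))
  (Order.min (frac_oo 1 (2 * L)
              * sqrte (frac_oo (3 * (1 - p1)) (delta1 * (G - 1))))
  (Order.min (frac_oo (3 * (1 - p3)) (4 * L * (p4 + delta2 * (G - 1))))
             (frac_oo (- b2 + Num.sqrt (b2 ^+ 2 + 4 * b1 * b3)) (2 * b1))))))%E.

End Rate.

(* Main.v *)
Require Import Defs.
From HB Require Import structures.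
From mathcomp Require Import all_boot all_order all_fingroup all_algebra.
From mathcomp Require Import all_classical all_reals all_analysis.
From mathcomp.real_closed Require Import complex mxtens.
From mathcomp Require Import ring lra.

Set Implicit Arguments.
Unset Strict Implicit.
Unset Printing Implicit Defensive.

Import Order.TTheory GRing.Theory Num.Theory.
Import numFieldNormedType.Exports.

Local Open Scope ring_scope.

(** The proof has two independent halves.

    The error recursion. The errors satisfy [r (k+1) <= B r k] entrywise
    ([error_vector_step]). Averages are untouched by mixing, and the average of
    the trackers is always the average of the local gradients, so the averaged
    iterate performs a gradient step for [f] with an error proportional to the
    disagreement of the nodes ([mean_descent_step]); such a step contracts the
    distance to the minimizer by [1 - alpha mu] ([gradient_step_contraction]).
    Disagreement is contracted by [beta] in each communication step and grows
    during local steps, but only linearly in their number, because the tracked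
    gradients grow by the factor [1 + alpha L] per local step and
    [alpha L n_g < 1] ([gradient_growth_linear]).

    The rate. For a nonnegative matrix [M] and a number [lam], a positive vector
    [v] with [M v < lam v] is a certificate: it bounds all eigenvalues by a number
    below [lam] ([spectral_radius_lt]), and it makes every nonnegative sequence
    with [r (k+1) <= M r k] decay like [lam^k] ([geometric_decay]). In dimension
    three such a vector can be read off the adjugate of [lam - M] as soon as the
    diagonal of [M] is below [lam] and [det (lam - M) > 0]
    ([det_shift_gt0_subinvariant]). For [lam = 1] both conditions follow from the
    bounds on the step size: these give lower bounds for the diagonal of [1 - B],
    and the quadratic inequality [b1 alpha^2 + b2 alpha < b3] then says that the
    leading term of the determinant dominates ([det_shift_B_gt0]). For
    [lam = rho B + eps] both conditions hold because the characteristic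
    polynomial has no real root beyond the spectral radius
    ([subinvariant_above_spectral_radius]). *)

(** * Euclidean norm and spectral norm *)

Section Euclidean.
Variable R : realType.

Section Vectors.
Variable m : nat.
Implicit Types u v w : 'cV[R]_m.

Lemma dotprodC u v : dotprod u v = dotprod v u.
Proof. by apply: eq_bigr => i _; rewrite mulrC. Qed.

Lemma dotprodDl u v w : dotprod (u + v) w = dotprod u w + dotprod v w.
Proof.
rewrite /dotprod -big_split /=.
by apply: eq_bigr => i _; rewrite mxE mulrDl.
Qed.

Lemma dotprodZl a u v : dotprod (a *: u) v = a * dotprod u v.
Proof. by rewrite /dotprod mulr_sumr; apply: eq_bigr => i _; rewrite mxE mulrA. Qed.

Lemma dotprodNl u v : dotprod (- u) v = - dotprod u v.
Proof. by rewrite -scaleN1r dotprodZl mulN1r. Qed.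

Lemma dotprodDr u v w : dotprod u (v + w) = dotprod u v + dotprod u w.
Proof. by rewrite dotprodC dotprodDl !(dotprodC u). Qed.

Lemma dotprodZr a u v : dotprod u (a *: v) = a * dotprod u v.
Proof. by rewrite dotprodC dotprodZl dotprodC. Qed.

Lemma dotprodNr u v : dotprod u (- v) = - dotprod u v.
Proof. by rewrite dotprodC dotprodNl dotprodC. Qed.

(** Rewriting with these rules turns a dot product of linear combinations into a
    polynomial in dot products of atoms, on which [lra] can work. *)
Definition dotprodE :=
  (dotprodDl, dotprodDr, dotprodZl, dotprodZr, dotprodNl, dotprodNr).

Lemma dotprod_ge0 v : 0 <= dotprod v v.
Proof. by apply: sumr_ge0 => i _; rewrite -expr2 sqr_ge0. Qed.

Lemma l2norm_ge0 v : 0 <= l2norm v.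
Proof. exact: sqrtr_ge0. Qed.

Lemma sqr_l2norm v : l2norm v ^+ 2 = dotprod v v.
Proof.
rewrite sqr_sqrtr; first by apply: eq_bigr => i _; rewrite expr2.
by apply: sumr_ge0 => i _; rewrite sqr_ge0.
Qed.

Lemma l2norm_sqrt v : l2norm v = Num.sqrt (dotprod v v).
Proof. by rewrite -sqr_l2norm sqrtr_sqr ger0_norm // l2norm_ge0. Qed.

Lemma l2norm_le v c : 0 <= c -> dotprod v v <= c ^+ 2 -> l2norm v <= c.
Proof.
by move=> c0; rewrite -sqr_l2norm ler_sqr ?nnegrE ?l2norm_ge0.
Qed.

Lemma l2norm_eq0 v : l2norm v = 0 -> v = 0.
Proof.
move=> v0; apply/matrixP => i j; rewrite (ord1 j) mxE.
have /eqP : \sum_i v i 0 ^+ 2 = 0.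
  transitivity (l2norm v ^+ 2); last by rewrite v0 expr0n.
  by rewrite sqr_l2norm; apply: eq_bigr => k _; rewrite expr2.
rewrite psumr_eq0 => [/allP /(_ i)|k _]; last exact: sqr_ge0.
by rewrite mem_index_enum => /(_ isT) /=; rewrite sqrf_eq0 => /eqP.
Qed.

Lemma l2norm0 : l2norm (0 : 'cV[R]_m) = 0.
Proof. by rewrite l2norm_sqrt -(scale0r 0) dotprodZl mul0r sqrtr0. Qed.

Lemma l2normZ a v : l2norm (a *: v) = `|a| * l2norm v.
Proof.
by rewrite !l2norm_sqrt !dotprodE mulrA -expr2 sqrtrM ?sqr_ge0 // sqrtr_sqr.
Qed.

Lemma l2normN v : l2norm (- v) = l2norm v.
Proof. by rewrite -scaleN1r l2normZ normrN1 mul1r. Qed.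

Lemma cauchy_schwarz u v : dotprod u v <= l2norm u * l2norm v.
Proof.
have [u0|u_neq0] := eqVneq (l2norm u) 0.
  by rewrite u0 mul0r (l2norm_eq0 u0) -(scale0r 0) dotprodZl mul0r.
have [v0|v_neq0] := eqVneq (l2norm v) 0.
  by rewrite v0 mulr0 (l2norm_eq0 v0) -(scale0r 0) dotprodZr mul0r.
have uv_gt0 : 0 < l2norm u * l2norm v.
  by rewrite mulr_gt0 // lt_neqAle eq_sym ?u_neq0 ?v_neq0 l2norm_ge0.
have := dotprod_ge0 (l2norm v *: u - l2norm u *: v).
rewrite !dotprodE (dotprodC v u) -!sqr_l2norm => H.
rewrite -(ler_pM2l uv_gt0); lra.
Qed.

Lemma l2normD u v : l2norm (u + v) <= l2norm u + l2norm v.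
Proof.
apply: l2norm_le; first by rewrite addr_ge0 ?l2norm_ge0.
rewrite !dotprodE (dotprodC v u) -!sqr_l2norm.
by have := cauchy_schwarz u v; lra.
Qed.

Lemma l2normB u v : l2norm (u - v) <= l2norm u + l2norm v.
Proof. by rewrite -(l2normN v) l2normD. Qed.

Lemma l2norm_const1_gt0 : (0 < m)%N -> 0 < l2norm (const_mx 1 : 'cV[R]_m).
Proof.
move=> m_gt0; rewrite lt_neqAle l2norm_ge0 andbT eq_sym.
apply: contraTneq isT => /l2norm_eq0 /matrixP /(_ (Ordinal m_gt0) 0).
by rewrite !mxE => /eqP; rewrite oner_eq0.
Qed.

End Vectors.

(** The Frobenius norm of [A] bounds the supremum that defines [op2norm A];
    without a bound that supremum would be a junk value. *)
Lemma op2norm_has_ubound m p (A : 'M[R]_(m, p)) :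
  has_ubound [set l2norm (A *m v) | v in [set v : 'cV[R]_p | l2norm v <= 1]]%classic.
Proof.
exists (Num.sqrt (\sum_i l2norm (row i A)^T ^+ 2)) => _ [v /= v1 <-].
apply: ler_wsqrtr; apply: ler_sum => i _.
have -> : (A *m v) i 0 = dotprod (row i A)^T v.
  by rewrite mxE; apply: eq_bigr => j _; rewrite !mxE.
rewrite -[leLHS]real_normK ?num_real // ler_sqr ?nnegrE ?normr_ge0 ?l2norm_ge0 //.
have aux w : l2norm w <= 1 -> dotprod (row i A)^T w <= l2norm (row i A)^T.
  move=> w1; apply: le_trans (cauchy_schwarz _ _) _.
  by rewrite ler_piMr // l2norm_ge0.
by rewrite ler_norml lerNl -dotprodNr !aux // l2normN.
Qed.

Lemma op2norm_ge0 m p (A : 'M[R]_(m, p)) : 0 <= op2norm A.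
Proof.
apply: ub_le_sup; first exact: op2norm_has_ubound.
by exists 0; rewrite /= ?mulmx0 l2norm0 ?ler01.
Qed.

Lemma op2norm_bound m p (A : 'M[R]_(m, p)) v :
  l2norm (A *m v) <= op2norm A * l2norm v.
Proof.
have [v0|v_neq0] := eqVneq (l2norm v) 0.
  by rewrite v0 mulr0 (l2norm_eq0 v0) mulmx0 l2norm0.
have v_gt0 : 0 < l2norm v by rewrite lt_neqAle eq_sym v_neq0 l2norm_ge0.
have iv_ge0 : 0 <= (l2norm v)^-1 by rewrite invr_ge0 ltW.
rewrite -ler_pdivrMr // mulrC.
apply: ub_le_sup; first exact: op2norm_has_ubound.
exists ((l2norm v)^-1 *: v) => /=; first by rewrite l2normZ ger0_norm ?mulVf.
by rewrite -scalemxAr l2normZ ger0_norm.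
Qed.

Lemma op2norm_le m p (A : 'M[R]_(m, p)) c :
  0 <= c -> (forall v, l2norm (A *m v) <= c * l2norm v) -> op2norm A <= c.
Proof.
move=> c0 Ac; apply: ge_sup.
  by exists (l2norm (A *m 0)), 0 => //=; rewrite l2norm0 ler01.
move=> _ [v /= v1 <-]; apply: le_trans (Ac v) _.
by rewrite ler_piMr.
Qed.

End Euclidean.

(** * Stacked vectors, consensus and mixing *)

Section Blocks.
Variables (R : realType) (n d : nat).
Implicit Types (x y : 'cV[R]_(n * d)) (v : 'I_n -> 'cV[R]_d) (W : 'M[R]_n).

Lemma sum_mxtens_index (F : 'I_(n * d) -> R) :
  \sum_k F k = \sum_(i < n) \sum_(j < d) F (mxtens_index (i, j)).
Proof.
rewrite pair_big /= (reindex (@mxtens_index n d)) /=; first by apply: eq_bigr => -[].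
by exists (@mxtens_unindex n d) => k _; rewrite (mxtens_indexK, mxtens_unindexK).
Qed.

Lemma dotprod_block x y : dotprod x y = \sum_i dotprod (block x i) (block y i).
Proof.
rewrite /dotprod sum_mxtens_index; apply: eq_bigr => i _.
by apply: eq_bigr => j _; rewrite !mxE.
Qed.

Lemma block_inj x y : (forall i, block x i = block y i) -> x = y.
Proof.
move=> xy; apply/matrixP => k j; rewrite (ord1 j) -(mxtens_unindexK k).
case: (mxtens_unindex k) => a b.
by have /matrixP /(_ b 0) := xy a; rewrite !mxE.
Qed.

Lemma block_stack v i : block (stack v) i = v i.
Proof.
by apply/matrixP => j k; rewrite (ord1 k) !mxE mxtens_indexK.
Qed.

Lemma blockD x y i : block (x + y) i = block x i + block y i.
Proof. by apply/matrixP => j k; rewrite !mxE. Qed.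

Lemma blockZ a x i : block (a *: x) i = a *: block x i.
Proof. by apply/matrixP => j k; rewrite !mxE. Qed.

Lemma blockB x y i : block (x - y) i = block x i - block y i.
Proof. by apply/matrixP => j k; rewrite !mxE. Qed.

Lemma meanD x y : mean (x + y) = mean x + mean y.
Proof.
by rewrite /mean -scalerDr -big_split /=; under eq_bigr do rewrite blockD.
Qed.

Lemma meanZ a x : mean (a *: x) = a *: mean x.
Proof.
rewrite /mean scalerA mulrC -scalerA; congr (_ *: _).
by rewrite scaler_sumr; under eq_bigr do rewrite blockZ.
Qed.

Lemma meanB x y : mean (x - y) = mean x - mean y.
Proof. by rewrite -scaleN1r meanD meanZ scaleN1r. Qed.

(** The part of a stacked vector that is orthogonal to consensus; its norm is the
    disagreement between the nodes. *)
Definition deviation x := x - repmean x.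

Lemma block_repmean x i : block (repmean x) i = mean x.
Proof. exact: block_stack. Qed.

Lemma block_deviation x i : block (deviation x) i = block x i - mean x.
Proof. by rewrite blockB block_repmean. Qed.

Lemma deviationD x y : deviation (x + y) = deviation x + deviation y.
Proof.
apply: block_inj => i; rewrite blockD !block_deviation blockD meanD.
by rewrite opprD addrACA.
Qed.

Lemma deviationZ a x : deviation (a *: x) = a *: deviation x.
Proof.
by apply: block_inj => i; rewrite blockZ !block_deviation blockZ meanZ scalerBr.
Qed.

Lemma deviationB x y : deviation (x - y) = deviation x - deviation y.
Proof. by rewrite -scaleN1r deviationD deviationZ scaleN1r. Qed.

Lemma block_kron W x i : block (kron_id d W *m x) i = \sum_j W i j *: block x j.
Proof.
apply/matrixP => c k; rewrite (ord1 k) summxE !mxE sum_mxtens_index.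
apply: eq_bigr => j _; rewrite !mxE /= (bigD1 c) //= big1 => [|b bc].
  by rewrite tensmxE mxE eqxx mulr1 addr0.
by rewrite tensmxE mxE eq_sym (negbTE bc) mulr0 mul0r.
Qed.

(** The Kronecker product acts on each of the [d] coordinate slices
    [(x_1c, .., x_nc)] separately as [W], so a bound for [W] passes to it slice
    by slice. *)
Lemma l2norm_kron W (c : R) x : 0 <= c ->
  (forall u, l2norm (W *m u) <= c * l2norm u) ->
  l2norm (kron_id d W *m x) <= c * l2norm x.
Proof.
move=> c0 Wc; apply: l2norm_le; first by rewrite mulr_ge0 // l2norm_ge0.
rewrite exprMn sqr_l2norm !dotprod_block /dotprod.
rewrite exchange_big [X in _ <= _ * X]exchange_big /= mulr_sumr.
apply: ler_sum => j _.
pose u : 'cV[R]_n := \col_i block x i j 0.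
have -> : \sum_i block x i j 0 * block x i j 0 = l2norm u ^+ 2.
  by rewrite sqr_l2norm; apply: eq_bigr => i _; rewrite !mxE.
rewrite -exprMn.
have -> : \sum_i block (kron_id d W *m x) i j 0 * block (kron_id d W *m x) i j 0
        = l2norm (W *m u) ^+ 2.
  rewrite sqr_l2norm; apply: eq_bigr => i _.
  suff -> : block (kron_id d W *m x) i j 0 = (W *m u) i 0 by [].
  by rewrite block_kron summxE mxE; apply: eq_bigr => k _; rewrite !mxE.
by rewrite ler_sqr ?nnegrE ?mulr_ge0 ?l2norm_ge0.
Qed.

Hypothesis n_gt0 : (0 < n)%N.

Let n_neq0 : n%:R != 0 :> R.
Proof. by rewrite pnatr_eq0 -lt0n. Qed.

Lemma sum_block x : \sum_i block x i = (n%:R : R) *: mean x.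
Proof.
rewrite /mean; set w := \sum_i block x i.
by rewrite scalerA mulfV // scale1r.
Qed.

Lemma mean_stack_const (u : 'cV[R]_d) : mean (stack (fun _ : 'I_n => u)) = u.
Proof.
rewrite /mean (eq_bigr (fun=> u)) => [|i _]; last by rewrite block_stack.
have -> : \sum_(i < n) u = (n%:R : R) *: u by rewrite sumr_const card_ord scaler_nat.
by rewrite scalerA mulVf // scale1r.
Qed.

Lemma mean_deviation x : mean (deviation x) = 0.
Proof. by rewrite meanB mean_stack_const subrr. Qed.

Lemma deviation_mean0 x : mean x = 0 -> deviation x = x.
Proof.
by move=> x0; apply: block_inj => i; rewrite block_deviation x0 subr0.
Qed.

Lemma dotprod_suml (u : 'cV[R]_d) v : dotprod (\sum_i v i) u = \sum_i dotprod (v i) u.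
Proof.
rewrite /dotprod exchange_big /=; apply: eq_bigr => j _.
by rewrite summxE mulr_suml.
Qed.

(** Pythagoras for the splitting of a stacked vector into consensus and
    disagreement, which are orthogonal. *)
Lemma sqr_l2norm_split x :
  l2norm x ^+ 2 = l2norm (deviation x) ^+ 2 + n%:R * l2norm (mean x) ^+ 2.
Proof.
rewrite !sqr_l2norm !dotprod_block.
have E i : dotprod (block (deviation x) i) (block (deviation x) i)
    = dotprod (block x i) (block x i) - 2 * dotprod (block x i) (mean x)
      + dotprod (mean x) (mean x).
  rewrite block_deviation; move: (mean x) => m.
  by rewrite !dotprodE (dotprodC m); ring.
rewrite (eq_bigr _ (fun i _ => E i)) big_split /= sumrB -mulr_sumr -dotprod_suml.
by rewrite sum_block dotprodZl sumr_const card_ord -mulr_natl; ring.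
Qed.

Lemma l2norm_deviation x : l2norm (deviation x) <= l2norm x.
Proof.
rewrite -[leRHS]ger0_norm ?l2norm_ge0 // -sqrtr_sqr sqr_l2norm_split.
rewrite -[leLHS]ger0_norm ?l2norm_ge0 // -sqrtr_sqr; apply: ler_wsqrtr.
by rewrite lerDl mulr_ge0 // sqr_ge0.
Qed.

Lemma l2norm_mean x : l2norm (mean x) <= l2norm x / Num.sqrt n%:R.
Proof.
rewrite ler_pdivlMr ?sqrtr_gt0 ?ltr0n //.
rewrite -[leRHS]ger0_norm ?l2norm_ge0 // -sqrtr_sqr sqr_l2norm_split.
rewrite -[X in X * _ <= _]ger0_norm ?l2norm_ge0 // -sqrtr_sqr.
rewrite -sqrtrM ?sqr_ge0 //; apply: ler_wsqrtr.
by rewrite [leRHS]addrC mulrC lerDl sqr_ge0.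
Qed.

Lemma l2norm_repmean x : l2norm x <= l2norm (deviation x) + Num.sqrt n%:R * l2norm (mean x).
Proof.
apply: l2norm_le; first by rewrite addr_ge0 ?mulr_ge0 ?sqrtr_ge0 ?l2norm_ge0.
rewrite -sqr_l2norm sqr_l2norm_split sqrrD exprMn [Num.sqrt n%:R ^+ 2]sqr_sqrtr ?ler0n //.
have : 0 <= l2norm (deviation x) * (Num.sqrt n%:R * l2norm (mean x)).
  by rewrite !mulr_ge0 ?sqrtr_ge0 ?l2norm_ge0.
by lra.
Qed.

Definition doubly_stochastic W :=
  [/\ forall i j, 0 <= W i j, forall i, \sum_j W i j = 1 & forall j, \sum_i W i j = 1].

Lemma communication_doubly_stochastic (e : rel 'I_n) W :
  communication_matrix e W -> doubly_stochastic W.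
Proof.
case=> _ [rW cW] Wii Wij Wij0; split=> // i j.
have [<-|ij] := eqVneq i j; first exact: ltW.
by case: (boolP (e i j)) => eij; [exact: Wij | rewrite Wij0].
Qed.

Section Mixing.
Variable W : 'M[R]_n.
Hypothesis dsW : doubly_stochastic W.

(** Each entry of [W u] is an average of the entries of [u], so by Jensen its
    square is at most the same average of squares; the column sums being [1],
    these averages add up to the squared norm of [u]. *)
Lemma doubly_stochastic_contract u : l2norm (W *m u) <= l2norm u.
Proof.
case: dsW => W_ge0 rW cW; apply: l2norm_le; first exact: l2norm_ge0.
rewrite sqr_l2norm /dotprod.
have -> : \sum_j u j 0 * u j 0 = \sum_i \sum_j W i j * u j 0 ^+ 2.
  rewrite exchange_big /=; apply: eq_bigr => j _.
  by rewrite -mulr_suml cW mul1r expr2.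
apply: ler_sum => i _; rewrite mxE; set m := \sum_j _.
have : 0 <= \sum_j W i j * (u j 0 - m) ^+ 2.
  by apply: sumr_ge0 => j _; rewrite mulr_ge0 ?sqr_ge0.
have E j : W i j * (u j 0 - m) ^+ 2
    = W i j * u j 0 ^+ 2 - W i j * u j 0 * (2 * m) + W i j * m ^+ 2 by ring.
rewrite (eq_bigr _ (fun j _ => E j)) big_split /= sumrB -!mulr_suml -/m rW.
by lra.
Qed.

Lemma mean_kron x : mean (kron_id d W *m x) = mean x.
Proof.
case: dsW => _ _ cW; rewrite /mean; congr (_ *: _).
under eq_bigr do rewrite block_kron.
rewrite exchange_big /=; apply: eq_bigr => j _.
by rewrite -scaler_suml cW scale1r.
Qed.

Lemma deviation_kron x : deviation (kron_id d W *m x) = kron_id d W *m deviation x.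
Proof.
case: dsW => _ rW _; apply: block_inj => i.
rewrite block_deviation mean_kron !block_kron.
under [RHS]eq_bigr do rewrite block_deviation scalerBr.
by rewrite sumrB -scaler_suml rW scale1r.
Qed.

(** On disagreement vectors [W] coincides with [W - 1 1^T / n], because the
    subtracted part only sees the mean, which vanishes there. *)
Lemma l2norm_kron_deviation x :
  l2norm (deviation (kron_id d W *m x)) <= beta W * l2norm (deviation x).
Proof.
rewrite deviation_kron.
have -> : kron_id d W *m deviation x
        = kron_id d (W - n%:R^-1 *: const_mx 1) *m deviation x.
  apply: block_inj => i; rewrite !block_kron.
  under [RHS]eq_bigr do rewrite !mxE mulr1 scalerBl.
  by rewrite sumrB -scaler_sumr -/(mean _) mean_deviation subr0.
apply: l2norm_kron; first exact: op2norm_ge0.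
by move=> u; exact: op2norm_bound.
Qed.

Variable k : nat.
Local Notation Z := (kron_id d W ^+ k).

Lemma exp_kron_ind (P : 'cV[R]_(n * d) -> nat -> Prop) x :
  P x 0%N -> (forall y j, P y j -> P (kron_id d W *m y) j.+1) -> P (Z *m x) k.
Proof.
move=> P0 PS; elim: k => [|j IHj]; first by rewrite expr0 mul1mx.
by rewrite exprS -mulmxA; exact: PS.
Qed.

Lemma mean_exp_kron x : mean (Z *m x) = mean x.
Proof.
by apply: (exp_kron_ind (P := fun y _ => mean y = mean x)) => // y _ <-; exact: mean_kron.
Qed.

Lemma l2norm_exp_kron x : l2norm (Z *m x) <= l2norm x.
Proof.
apply: (exp_kron_ind (P := fun y _ => l2norm y <= l2norm x)) => // y _; apply: le_trans.
rewrite -[leRHS]mul1r; apply: l2norm_kron => // u.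
by rewrite mul1r doubly_stochastic_contract.
Qed.

Lemma deviation_exp_kron x : deviation (Z *m x) = Z *m deviation x.
Proof.
elim: k => [|j IHj]; first by rewrite !expr0 !mul1mx.
by rewrite exprS -!mulmxA deviation_kron IHj.
Qed.

Lemma l2norm_deviation_exp_kron x :
  l2norm (deviation (Z *m x)) <= beta W ^+ k * l2norm (deviation x).
Proof.
pose P y j := l2norm (deviation y) <= beta W ^+ j * l2norm (deviation x).
apply: (exp_kron_ind (P := P)); first by rewrite /P expr0 mul1r.
move=> y j; rewrite /P => yj; apply: le_trans (l2norm_kron_deviation y) _.
by rewrite exprS -mulrA ler_wpM2l // op2norm_ge0.
Qed.

Lemma op2norm_exp_kronB1 : op2norm (Z - 1%:M) <= 2.
Proof.
apply: op2norm_le => // u; rewrite mulmxBl mul1mx.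
apply: le_trans (l2normB _ _) _; have := l2norm_exp_kron u; lra.
Qed.

End Mixing.
End Blocks.

(** * Gradient steps for smooth strongly convex functions *)

Section ConvexFunctions.
Variables (R : realType) (d : nat).
Implicit Types (f : 'cV[R]_d -> R) (z : 'cV[R]_d) (mu L alpha : R).

(** Quadratic upper bound from a Lipschitz gradient, for convex [f]. Cut the
    segment into [N] pieces: convexity bounds the increase of [f] over a piece by
    the slope at its far end, and the slope at parameter [t] exceeds the initial
    one by at most [L * t * |D|^2]. The sum is the claim with [L / 2] replaced by
    [L / 2 * (1 + 1 / N)]; let [N] grow. *)
Lemma descent_lemma f mu L (z D : 'cV[R]_d) : 0 < mu -> 0 <= L ->
  strongly_convex mu f -> lipschitz_grad L f ->
  f (z + D) <= f z + dotprod (grad f z) D + L / 2 * dotprod D D.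
Proof.
move=> mu_gt0 L_ge0 scf lipf.
have convex w w' : f w + dotprod (grad f w) (w' - w) <= f w'.
  apply: le_trans (scf w w'); rewrite lerDl mulr_ge0 ?sqr_ge0 //.
  by rewrite divr_ge0 ?ltW.
have step (t : R) : 0 <= t ->
    dotprod (grad f (z + t *: D)) D <= dotprod (grad f z) D + L * t * dotprod D D.
  move=> t0; rewrite -lerBlDl -dotprodNl -dotprodDl.
  apply: le_trans (cauchy_schwarz _ _) _.
  rewrite -sqr_l2norm expr2 mulrA; apply: ler_wpM2r; first exact: l2norm_ge0.
  apply: le_trans (lipf _ _) _.
  by rewrite [z + _]addrC addrK l2normZ ger0_norm // mulrA.
have partial (h : R) i : 0 <= h -> f (z + (i%:R * h) *: D) <=
    f z + i%:R * h * dotprod (grad f z) D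
      + L * dotprod D D * h ^+ 2 * (i%:R * (i%:R + 1) / 2).
  move=> h0; elim: i => [|i IHi]; first by rewrite !mul0r scale0r !mulr0 !addr0.
  have := convex (z + (i.+1%:R * h) *: D) (z + (i%:R * h) *: D).
  have -> : z + (i%:R * h) *: D - (z + (i.+1%:R * h) *: D) = (- h) *: D.
    rewrite opprD addrACA subrr add0r -scalerBl; congr (_ *: _).
    by rewrite -[i.+1%:R]natr1; ring.
  rewrite dotprodZr.
  have := ler_wpM2l h0 (step _ (mulr_ge0 (ler0n R i.+1) h0)).
  move: IHi; rewrite -[i.+1%:R]natr1; set a := dotprod (grad f _) D.
  by move: (f _) (f _) => b c; lra.
apply/ler_addgt0Pr => eps eps_gt0.
have DD_ge0 := dotprod_ge0 D.
pose N := (Num.truncn (L * dotprod D D / eps)).+1.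
have N_gt0 : 0 < N%:R :> R by rewrite ltr0n.
have N_big : L * dotprod D D < N%:R * eps.
  by rewrite -ltr_pdivrMr // truncnS_gt.
have := partial N%:R^-1 N; rewrite invr_ge0 ltW // mulfV ?gt_eqF // scale1r => /(_ isT).
move/le_trans; apply; rewrite mul1r; set c := L * _ * _ * _.
have -> : c = L / 2 * dotprod D D + L * dotprod D D / N%:R / 2.
  by rewrite /c; field; rewrite gt_eqF.
have : L * dotprod D D / N%:R < eps by rewrite ltr_pdivrMr // [eps * _]mulrC.
by lra.
Qed.

Lemma strong_convexity_le_lipschitz f mu L : (0 < d)%N ->
  strongly_convex mu f -> lipschitz_grad L f -> mu <= L.
Proof.
move=> d_gt0 scf lipf.
pose u : 'cV[R]_d := const_mx 1.
have u_gt0 : 0 < l2norm u ^+ 2 by rewrite exprn_gt0 // l2norm_const1_gt0.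
have := scf 0 u; have := scf u 0.
have := cauchy_schwarz (grad f u - grad f 0) u.
have := ler_wpM2r (l2norm_ge0 u) (lipf u 0).
rewrite subr0 sub0r l2normN !dotprodE -(mulrA L) -expr2.
move: (l2norm u ^+ 2) u_gt0 => a a_gt0 H1 H2 H3 H4.
by rewrite -(ler_pM2r a_gt0); lra.
Qed.

(** A gradient step of length [1 / (2 L)] from the minimizer reaches a point [z]
    at which, by convexity, the slope along [g := grad f xs] is nonpositive, while
    by the Lipschitz bound it is at least [|g|^2 / 2]. *)
Lemma minimizer_stationary f mu L xs : 0 < mu -> 0 < L ->
  strongly_convex mu f -> lipschitz_grad L f -> is_minimizer f xs -> grad f xs = 0.
Proof.
move=> mu_gt0 L_gt0 scf lipf xs_min; apply: l2norm_eq0.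
set g := grad f xs; pose t := (2 * L)^-1.
have t_gt0 : 0 < t by rewrite invr_gt0 mulr_gt0.
have := scf (xs - t *: g) xs; have := xs_min (xs - t *: g).
have := lipf xs (xs - t *: g).
have -> : xs - (xs - t *: g) = t *: g by rewrite opprB addrC subrK.
rewrite -/g; set g' := grad f (xs - t *: g).
rewrite dotprodZr l2normZ gtr0_norm // mulrA.
have -> : L * t = 1 / 2 by rewrite /t; field; rewrite gt_eqF.
move=> lip le1 le2.
have g'g : dotprod g' g <= 0.
  rewrite -(pmulr_rle0 _ t_gt0).
  have : 0 <= mu / 2 * (t * l2norm g) ^+ 2.
    by rewrite mulr_ge0 ?sqr_ge0 // divr_ge0 // ltW.
  by lra.
have := ler_wpM2r (l2norm_ge0 g) lip.
have := cauchy_schwarz (g - g') g; rewrite !dotprodE -sqr_l2norm => cs lip'.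
apply/eqP; rewrite -sqrf_eq0 eq_le sqr_ge0 andbT.
by move: cs lip' g'g; rewrite expr2; lra.
Qed.

(** Cocoercivity of the gradient of [f - mu/2 |.|^2], whose increment from [x] to
    [y] is [H]. This function is convex and [L - mu]-smooth; comparing its tangent
    at one point with its quadratic upper bound at the other point, moved by
    [c * H], and exchanging the roles of [x] and [y] gives two inequalities whose
    sum is the claim. They are stated for [f] itself below. *)
Lemma cocoercive f mu L (c : R) (x y D H : 'cV[R]_d) :
  0 < mu -> mu <= L -> 0 <= c -> (L - mu) * c <= 1 ->
  strongly_convex mu f -> lipschitz_grad L f ->
  D = y - x -> H = grad f y - grad f x - mu *: D ->
  c * dotprod H H <= dotprod D H.
Proof.
move=> mu_gt0 muL c_ge0 c_le scf lipf defD defH.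
have L_ge0 : 0 <= L by apply: le_trans muL; exact: ltW.
have := scf x (y - c *: H); have := descent_lemma y (- (c *: H)) mu_gt0 L_ge0 scf lipf.
have := scf y (x + c *: H); have := descent_lemma x (c *: H) mu_gt0 L_ge0 scf lipf.
have -> : y - c *: H - x = D - c *: H by rewrite defD addrAC.
have -> : x + c *: H - y = - (D - c *: H) by apply/matrixP => i j; rewrite defD !mxE; ring.
rewrite !sqr_l2norm => d1 s1 d2 s2.
have : dotprod H (D - c *: H) = dotprod (grad f y) (D - c *: H)
  - dotprod (grad f x) (D - c *: H) - mu * dotprod D (D - c *: H).
  by rewrite {1}defH !dotprodDl !dotprodNl dotprodZl.
have : c * dotprod H H
    = c * (dotprod (grad f y) H - dotprod (grad f x) H - mu * dotprod D H).
  by rewrite {1}defH !dotprodDl !dotprodNl dotprodZl.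
have HH := dotprod_ge0 H.
have := ler_wpM2r (mulr_ge0 c_ge0 HH) c_le.
move: HH d1 s1 d2 s2; rewrite !dotprodE (dotprodC H D).
move: (dotprod H H) (dotprod D H) (dotprod D D) (dotprod (grad f x) H) (dotprod (grad f y) H) (dotprod (grad f y) D) (dotprod (grad f x) D) => HH DH DD xH yH yD xD.
move: (f _) (f _) (f _) (f _) => f1 f2 f3 f4.
lra.
Qed.

(** With [D := x - y] and [H] as in [cocoercive], the difference of the two steps
    is [(1 - alpha mu) D - alpha H]; after squaring, the cross term and
    [alpha^2 |H|^2] add up to something nonpositive by cocoercivity. *)
Lemma gradient_step_contraction f mu L alpha (x y : 'cV[R]_d) : 0 < mu -> mu <= L ->
  0 < alpha -> alpha * L < 1 -> strongly_convex mu f -> lipschitz_grad L f ->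
  l2norm (x - alpha *: grad f x - (y - alpha *: grad f y))
    <= (1 - alpha * mu) * l2norm (x - y).
Proof.
move=> mu_gt0 muL alpha_gt0 alphaL scf lipf.
have alphamu : alpha * mu <= alpha * L by rewrite ler_pM2l.
have lam_gt0 : 0 < 1 - alpha * mu by lra.
(* The largest c for which cocoercivity follows from alpha * (L + mu) <= 2;
   it makes the cross term and the quadratic term cancel exactly. *)
pose c := alpha / (2 * (1 - alpha * mu)).
have c_ge0 : 0 <= c by rewrite divr_ge0 ?mulr_ge0 // ltW.
have c_le : (L - mu) * c <= 1.
  by rewrite mulrA ler_pdivrMr ?mulr_gt0 //; lra.
have := cocoercive mu_gt0 muL c_ge0 c_le scf lipf (erefl (x - y)) erefl.
set D := x - y; set H := grad f x - _ - _ => cH.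
have -> : x - alpha *: grad f x - (y - alpha *: grad f y)
    = (1 - alpha * mu) *: D - alpha *: H.
  by apply/matrixP => i j; rewrite /H /D !mxE; ring.
clearbody H D.
apply: l2norm_le; first by rewrite mulr_ge0 ?l2norm_ge0 // ltW.
rewrite exprMn sqr_l2norm !dotprodE (dotprodC H D).
have : alpha ^+ 2 * dotprod H H <= 2 * alpha * (1 - alpha * mu) * dotprod D H.
  have -> : alpha ^+ 2 * dotprod H H = 2 * alpha * (1 - alpha * mu) * (c * dotprod H H).
    by rewrite /c; field; rewrite gt_eqF.
  by rewrite ler_wpM2l // !mulr_ge0 // ltW.
by lra.
Qed.

Lemma grad_average n (fs : 'I_n -> 'cV[R]_d -> R) z :
  (forall i, differentiable (fs i) z) ->
  grad (average fs) z = n%:R^-1 *: \sum_i grad (fs i) z.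
Proof.
move=> dfs; apply/matrixP => j k; rewrite !mxE summxE.
have -> : average fs = n%:R^-1 \*: (\sum_i fs i).
  by apply/funext => w; rewrite /average /= fct_sumE.
have der i : derivable (fs i) z (delta_mx j 0) by exact: diff_derivable.
rewrite deriveZ; last exact: derivable_sum.
rewrite derive_sum //; congr (_ * _).
by apply: eq_bigr => i _; rewrite mxE.
Qed.

End ConvexFunctions.

(** * Local computation steps *)

Lemma exp_1D_le (R : realFieldType) (t : R) j :
  0 <= t -> j%:R * t <= 1 -> (1 + t) ^+ j <= 1 + 2 * (j%:R * t).
Proof.
move=> t_ge0 jt_le1.
(* The quadratic bound is preserved by induction, the linear one is not. *)
suff : (1 + t) ^+ j <= 1 + j%:R * t + (j%:R * t) ^+ 2.
  have : (j%:R * t) ^+ 2 <= j%:R * t by rewrite expr2 ler_piMl ?mulr_ge0.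
  by lra.
elim: j jt_le1 => [|j IHj]; first by rewrite !mul0r expr0n /= !addr0 expr0.
rewrite -[j.+1%:R]natr1 exprS; move: (ler0n R j) => j_ge0 jt_le1.
have jt : j%:R * t <= 1 by lra.
have t1_ge0 : 0 <= 1 + t by rewrite addr_ge0.
apply: le_trans (ler_wpM2l t1_ge0 (IHj jt)) _.
have t2_ge0 : 0 <= t ^+ 2 by rewrite sqr_ge0.
have jt_ge0 := mulr_ge0 j_ge0 t_ge0.
have : (j%:R * t ^+ 2) * (j%:R * t) <= (j%:R * t ^+ 2) * 1.
  by rewrite ler_wpM2l // mulr_ge0.
by lra.
Qed.

Section StackedGradient.
Variables (R : realType) (n d : nat) (L : R) (fs : 'I_n -> 'cV[R]_d -> R).
Hypothesis n_gt0 : (0 < n)%N.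
Hypothesis L_ge0 : 0 <= L.
Hypothesis fs_diff : forall i z, differentiable (fs i) z.
Hypothesis fs_lip : forall i, lipschitz_grad L (fs i).

Local Notation s := (Num.sqrt (n%:R : R)).
Local Notation F := (stacked_grad fs).
Local Notation f := (average fs).

Let s_gt0 : 0 < s.
Proof. by rewrite sqrtr_gt0 ltr0n. Qed.

Lemma l2norm_stacked_grad (x y : 'cV[R]_(n * d)) :
  l2norm (F x - F y) <= L * l2norm (x - y).
Proof.
apply: l2norm_le; first by rewrite mulr_ge0 ?l2norm_ge0.
rewrite exprMn sqr_l2norm !dotprod_block mulr_sumr; apply: ler_sum => i _.
rewrite !blockB !block_stack -!sqr_l2norm -exprMn.
by rewrite ler_sqr ?nnegrE ?mulr_ge0 ?l2norm_ge0 // fs_lip.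
Qed.

Lemma l2norm_stack_const (u : 'cV[R]_d) :
  l2norm (stack (fun _ : 'I_n => u)) = s * l2norm u.
Proof.
rewrite !l2norm_sqrt -sqrtrM ?ler0n // dotprod_block; congr Num.sqrt.
under eq_bigr do rewrite block_stack.
by rewrite sumr_const card_ord mulr_natl.
Qed.

Lemma mean_stacked_grad_const z : mean (F (stack (fun=> z))) = grad f z.
Proof.
rewrite grad_average /mean => [|i]; last exact: fs_diff.
by congr (_ *: _); apply: eq_bigr => i _; rewrite !block_stack.
Qed.

(** The averaged gradient that the nodes use differs from the gradient of [f] at
    the averaged point only through disagreement. *)
Lemma mean_stacked_grad (x : 'cV[R]_(n * d)) :
  l2norm (mean (F x) - grad f (mean x)) <= L / s * l2norm (deviation x).
Proof.
rewrite -mean_stacked_grad_const -meanB.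
apply: le_trans (l2norm_mean _ _) _ => //; rewrite mulrAC.
by rewrite ler_wpM2r ?invr_ge0 ?(ltW s_gt0) // l2norm_stacked_grad.
Qed.

Lemma lipschitz_grad_average : lipschitz_grad L f.
Proof.
move=> z z'; rewrite -!mean_stacked_grad_const -meanB.
apply: le_trans (l2norm_mean _ _) _ => //.
rewrite ler_pdivrMr //; apply: le_trans (l2norm_stacked_grad _ _) _.
have -> : stack (fun=> z) - stack (fun=> z') = stack (fun _ : 'I_n => z - z').
  by apply: block_inj => i; rewrite blockB !block_stack.
by rewrite l2norm_stack_const mulrA mulrAC.
Qed.

End StackedGradient.

Section InnerLoop.
Variables (R : realType) (n d : nat) (alpha mu L : R).
Variables (fs : 'I_n -> 'cV[R]_d -> R) (xs : 'cV[R]_d).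
Hypothesis n_gt0 : (0 < n)%N.
Hypothesis fs_diff : forall i z, differentiable (fs i) z.
Hypothesis fs_lip : forall i, lipschitz_grad L (fs i).
Hypothesis mu_gt0 : 0 < mu.
Hypothesis mu_le_L : mu <= L.
Hypothesis f_sc : strongly_convex mu (average fs).
Hypothesis xs_min : is_minimizer (average fs) xs.
Hypothesis alpha_gt0 : 0 < alpha.

Local Notation s := (Num.sqrt (n%:R : R)).
Local Notation F := (stacked_grad fs).
Local Notation f := (average fs).

Variables (T : nat) (X Y : nat -> 'cV[R]_(n * d)).
Hypothesis alphaL_lt1 : alpha * (T.+1%:R * L) < 1.
Hypothesis X_step : forall j, (j < T)%N -> X j.+1 = X j - alpha *: Y j.
Hypothesis Y_step : forall j, (j < T)%N -> Y j.+1 = Y j + F (X j.+1) - F (X j).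
Hypothesis mean_Y0 : mean (Y 0%N) = mean (F (X 0%N)).

Local Notation a := (l2norm (mean (X 0%N) - xs)).
Local Notation b := (l2norm (deviation (X 0%N))).
Local Notation c := (l2norm (deviation (Y 0%N))).
Local Notation t := (alpha * L).

(** A bound for the initial tracked gradient [Y 0] by the three errors. All the
    terms of the error matrix that come from repeated local steps are multiples
    of it. *)
Definition total_error := s * L * a + L * b + c.
Local Notation S := total_error.

Let L_gt0 : 0 < L. Proof. exact: lt_le_trans mu_le_L. Qed.
Let L_ge0 : 0 <= L. Proof. exact: ltW. Qed.
Let s_gt0 : 0 < s. Proof. by rewrite sqrtr_gt0 ltr0n. Qed.
Let t_gt0 : 0 < t. Proof. exact: mulr_gt0. Qed.
Let f_lip : lipschitz_grad L f. Proof. exact: lipschitz_grad_average. Qed.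

Let jt_le1 j : (j <= T.+1)%N -> j%:R * t <= 1.
Proof.
move=> jT; apply: le_trans (ltW alphaL_lt1).
by rewrite mulrCA ler_pM2l // ler_pM2r // ler_nat.
Qed.

Let t_lt1 : t < 1.
Proof.
apply: le_lt_trans alphaL_lt1; rewrite ler_pM2l // ler_peMl //.
by rewrite ler1n.
Qed.

Lemma total_error_ge0 : 0 <= S.
Proof. by rewrite !addr_ge0 ?mulr_ge0 ?l2norm_ge0 ?sqrtr_ge0. Qed.

Lemma deviation_le_total_error : c <= S.
Proof. by rewrite lerDr addr_ge0 ?mulr_ge0 ?l2norm_ge0 ?sqrtr_ge0. Qed.

(** The updates of [Y] telescope over local steps. *)
Lemma gradient_tracked j : (j <= T)%N -> Y j = Y 0%N + (F (X j) - F (X 0%N)).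
Proof.
elim: j => [|j IHj] jT; first by rewrite subrr addr0.
rewrite Y_step // IHj ?(ltnW jT) //.
by apply/matrixP => i k; rewrite !mxE; ring.
Qed.

Lemma mean_gradient_tracked j : (j <= T)%N -> mean (Y j) = mean (F (X j)).
Proof. by move=> jT; rewrite gradient_tracked // meanD meanB mean_Y0 addrC subrK. Qed.

(** The consensus part of [Y 0] is the averaged gradient, which is within
    [L / sqrt n * |deviation (X 0)|] of [grad f] at the mean, and the latter
    vanishes at [xs]. *)
Lemma initial_gradient_bound : l2norm (Y 0%N) <= S.
Proof.
apply: le_trans (l2norm_repmean _ _) _ => //; rewrite [leRHS]addrC lerD2l mean_Y0.
have s_neq0 : s != 0 by rewrite gt_eqF.
have -> : s * L * a + L * b = s * (L * a + L / s * b) by field.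
rewrite ler_pM2l //.
have -> : mean (F (X 0%N)) = grad f (mean (X 0%N)) + (mean (F (X 0%N)) - grad f (mean (X 0%N))).
  by rewrite addrC subrK.
apply: le_trans (l2normD _ _) _; apply: lerD; last exact: mean_stacked_grad.
rewrite -[X in l2norm X]subr0 -(minimizer_stationary mu_gt0 L_gt0 f_sc f_lip xs_min).
exact: f_lip.
Qed.

(** Discrete Gronwall: a step of length [alpha * |Y j|] changes the gradients by at
    most [alpha * L * |Y j|], so the gradients grow at most by the factor
    [1 + alpha * L] per local step. *)
Lemma gradient_growth j : (j <= T)%N ->
  l2norm (Y j) <= (1 + t) ^+ j * S /\ L * l2norm (X j - X 0%N) <= ((1 + t) ^+ j - 1) * S.
Proof.
move=> jT; suff Xj : L * l2norm (X j - X 0%N) <= ((1 + t) ^+ j - 1) * S.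
  split=> //; rewrite gradient_tracked //; apply: le_trans (l2normD _ _) _.
  have := l2norm_stacked_grad L_ge0 fs_lip (X j) (X 0%N).
  by have := initial_gradient_bound; lra.
elim: j jT => [|j IHj] jT; first by rewrite subrr l2norm0 expr0 subrr mulr0 mul0r.
have Xj := IHj (ltnW jT).
have Yj : l2norm (Y j) <= (1 + t) ^+ j * S.
  rewrite gradient_tracked ?(ltnW jT) //; apply: le_trans (l2normD _ _) _.
  have := l2norm_stacked_grad L_ge0 fs_lip (X j) (X 0%N).
  by have := initial_gradient_bound; lra.
rewrite X_step // addrAC; apply: le_trans (ler_wpM2l L_ge0 (l2normB _ _)) _.
rewrite l2normZ gtr0_norm // exprS.
by have := ler_wpM2l (ltW t_gt0) Yj; lra.
Qed.

(** The geometric growth is linear in the number of steps since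
    [alpha * L * T.+1 < 1]. *)
Lemma gradient_growth_linear j : (j <= T)%N ->
  l2norm (Y j) <= (1 + 2 * (j%:R * t)) * S /\ L * l2norm (X j - X 0%N) <= 2 * (j%:R * t) * S.
Proof.
move=> jT; have [Yj Xj] := gradient_growth jT.
have := ler_wpM2r total_error_ge0 (exp_1D_le (ltW t_gt0) (jt_le1 (leqW jT))).
by split; lra.
Qed.

Lemma deviation_Y_bound j : (j <= T)%N ->
  l2norm (deviation (Y j)) <= c + 2 * (j%:R * t) * S.
Proof.
move=> jT; rewrite gradient_tracked // deviationD; apply: le_trans (l2normD _ _) _.
rewrite lerD2l; apply: le_trans (l2norm_deviation _ _) _ => //.
apply: le_trans (l2norm_stacked_grad L_ge0 fs_lip _ _) _.
by have [] := gradient_growth_linear jT.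
Qed.

Lemma deviation_X_bound j : (j <= T)%N ->
  l2norm (deviation (X j)) <= b + alpha * (j%:R * c + t * (j%:R * (j%:R - 1)) * S).
Proof.
elim: j => [|j IHj] jT; first by rewrite !mul0r mulr0 mul0r addr0 mulr0 addr0.
rewrite X_step // deviationB deviationZ; apply: le_trans (l2normB _ _) _.
rewrite l2normZ gtr0_norm // -[j.+1%:R]natr1.
have := ler_wpM2l (ltW alpha_gt0) (deviation_Y_bound (ltnW jT)).
by have := IHj (ltnW jT); lra.
Qed.

Lemma deviation_X_bound_linear j : (j <= T)%N ->
  l2norm (deviation (X j)) <= b + 2 * alpha * j%:R * S.
Proof.
move=> jT; apply: le_trans (deviation_X_bound jT) _; rewrite lerD2l.
have -> : 2 * alpha * j%:R * S = alpha * (2 * j%:R * S) by ring.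
rewrite ler_pM2l //.
have j_ge0 := ler0n R j.
have := ler_wpM2l j_ge0 deviation_le_total_error.
have := ler_wpM2r total_error_ge0 (ler_wpM2l j_ge0 (jt_le1 (leqW jT))).
have := mulr_ge0 (mulr_ge0 (ltW t_gt0) j_ge0) total_error_ge0.
by lra.
Qed.

(** The averaged iterate performs a gradient step for [f], with an error in the
    gradient that is controlled by disagreement. *)
Lemma mean_descent_step j : (j <= T)%N ->
  l2norm (mean (X j) - alpha *: mean (Y j) - xs)
    <= (1 - alpha * mu) * l2norm (mean (X j) - xs)
       + alpha * L / s * l2norm (deviation (X j)).
Proof.
move=> jT; rewrite mean_gradient_tracked //.
set m := mean (X j); set g := mean (F (X j)).
have gs0 := minimizer_stationary mu_gt0 L_gt0 f_sc f_lip xs_min.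
have -> : m - alpha *: g - xs
    = (m - alpha *: grad f m - (xs - alpha *: grad f xs)) - alpha *: (g - grad f m).
  by rewrite gs0; apply/matrixP => i k; rewrite !mxE; ring.
apply: le_trans (l2normB _ _) _; apply: lerD.
  exact: gradient_step_contraction f_lip.
rewrite l2normZ gtr0_norm // -!mulrA ler_pM2l // mulrA.
exact: mean_stacked_grad.
Qed.

Local Notation lam := (1 - alpha * mu).
(** A supersolution of the recursion in [mean_descent_step] once the disagreement at
    step [j] is replaced by [b + 2 * alpha * j * S]: the first part of that bound
    sums geometrically, the second one quadratically. *)
Definition mean_bound j := lam ^+ j * a + L / mu / s * (1 - lam ^+ j) * b
  + alpha ^+ 2 * L / s * (j%:R * (j%:R - 1)) * S.

(** Stated for the updated mean and not for [mean (X j.+1)] because it also applies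
    to the last local step, which is followed by communication; mixing does not
    change means. *)
Lemma mean_bound_step j : (j <= T)%N -> l2norm (mean (X j) - xs) <= mean_bound j ->
  l2norm (mean (X j) - alpha *: mean (Y j) - xs) <= mean_bound j.+1.
Proof.
move=> jT IHj; apply: le_trans (mean_descent_step jT) _.
have lam_ge0 : 0 <= lam.
  have : alpha * mu <= t by rewrite ler_pM2l.
  by have := t_lt1; lra.
have lam_le1 : lam <= 1 by rewrite lerBlDr lerDl ltW // mulr_gt0.
have w_ge0 : 0 <= alpha * L / s by rewrite divr_ge0 // ltW.
have S_ge0 := total_error_ge0.
have := ler_wpM2l w_ge0 (deviation_X_bound_linear jT).
have := ler_wpM2l lam_ge0 IHj.
set e := alpha ^+ 2 * L / s * (j%:R * (j%:R - 1)) * S.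
have e_ge0 : 0 <= e.
  have jj : 0 <= j%:R * (j%:R - 1) :> R.
    by case: (j) => [|i]; rewrite ?mul0r // mulr_ge0 // subr_ge0 ler1n.
  by rewrite mulr_ge0 // mulr_ge0 // divr_ge0 ?mulr_ge0 ?sqr_ge0 // ltW.
have lam_e : lam * e <= e by rewrite ler_piMl.
have -> : lam * mean_bound j
    = lam ^+ j.+1 * a + (L / mu / s * (1 - lam ^+ j.+1) * b - t / s * b) + lam * e.
  rewrite /mean_bound /e [lam ^+ j.+1]exprS; move: (lam ^+ j) => p; field.
  by rewrite !gt_eqF.
have -> : mean_bound j.+1
    = lam ^+ j.+1 * a + L / mu / s * (1 - lam ^+ j.+1) * b + e + t / s * (2 * alpha * j%:R * S).
  rewrite /mean_bound /e -[j.+1%:R]natr1; move: (lam ^+ j.+1) => p; field.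
  by rewrite !gt_eqF.
by lra.
Qed.

Lemma mean_error_bound j : (j <= T)%N -> l2norm (mean (X j) - xs) <= mean_bound j.
Proof.
elim: j => [|j IHj] jT.
  by rewrite /mean_bound expr0 subrr mulr0 !mul0r mulr0 mul0r !addr0 mul1r.
rewrite X_step // meanB meanZ; apply: mean_bound_step; first exact: ltnW.
by apply: IHj; exact: ltnW.
Qed.

End InnerLoop.

(** * One outer iteration *)

Section OrderThree.
Variable R : realType.

Definition o0 : 'I_3 := @Ordinal 3 0 isT.
Definition o1 : 'I_3 := @Ordinal 3 1 isT.
Definition o2 : 'I_3 := @Ordinal 3 2 isT.

Lemma ord3_ind (P : 'I_3 -> Prop) : P o0 -> P o1 -> P o2 -> forall i, P i.
Proof.
by move=> P0 P1 P2 [[|[|[|]]] // Hi];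
  [move: P0|move: P1|move: P2]; congr P; apply: val_inj.
Qed.

Lemma sum_ord3 (E : 'I_3 -> R) : \sum_i E i = E o0 + E o1 + E o2.
Proof.
rewrite !big_ord_recl big_ord0 addr0 addrA.
by congr (E _ + E _ + E _); apply: val_inj.
Qed.

End OrderThree.

Section OuterStep.
Variables (R : realType) (n d nc T : nat) (alpha mu L : R).
Variables W1 W2 W3 W4 : 'M[R]_n.
Variables (fs : 'I_n -> 'cV[R]_d -> R) (xs : 'cV[R]_d).
Variables x y : nat -> nat -> 'cV[R]_(n * d).
Hypothesis n_gt0 : (0 < n)%N.
Hypothesis fs_diff : forall i z, differentiable (fs i) z.
Hypothesis fs_lip : forall i, lipschitz_grad L (fs i).
Hypothesis mu_gt0 : 0 < mu.
Hypothesis mu_le_L : mu <= L.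
Hypothesis f_sc : strongly_convex mu (average fs).
Hypothesis xs_min : is_minimizer (average fs) xs.
Hypothesis alpha_gt0 : 0 < alpha.
Hypothesis alphaL_lt1 : alpha * (T.+1%:R * L) < 1.
Hypothesis ds1 : doubly_stochastic W1.
Hypothesis ds2 : doubly_stochastic W2.
Hypothesis ds3 : doubly_stochastic W3.
Hypothesis ds4 : doubly_stochastic W4.
Hypothesis xy_gt : gradient_tracking nc T.+1 alpha W1 W2 W3 W4 fs x y.

Local Notation s := (Num.sqrt (n%:R : R)).
Local Notation F := (stacked_grad fs).
Local Notation Z W := (kron_id d W ^+ nc).
Local Notation G := (T.+1%:R : R).
Local Notation p W := (beta W ^+ nc).
Local Notation zeta := (op2norm (Z W1 - 1%:M)).
Local Notation delta1' := (delta1 nc T.+1 W1 W2).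
Local Notation delta2' := (delta2 d nc T.+1 W1 W3 W4).

Let L_gt0 : 0 < L. Proof. exact: lt_le_trans mu_le_L. Qed.

Let x_inner k j : (j < T)%N -> x k j.+2 = x k j.+1 - alpha *: y k j.+1.
Proof. by case: xy_gt => _ H _ _ jT; have [] := H k j.+1 jT. Qed.

Let y_inner k j : (j < T)%N -> y k j.+2 = y k j.+1 + F (x k j.+2) - F (x k j.+1).
Proof. by case: xy_gt => _ H _ _ jT; have [] := H k j.+1 jT. Qed.

(** The invariant of gradient tracking: doubly stochastic mixing preserves averages,
    and every update adds the same average increment to trackers and gradients. *)
Lemma mean_y_tracks k : mean (y k 1%N) = mean (F (x k 1%N)).
Proof.
case: xy_gt => y0 _ _ yS; elim: k => [|k IHk]; first by rewrite y0.
rewrite yS meanD !mean_exp_kron // meanB.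
have := mean_gradient_tracked (X := fun j => x k j.+1) (Y := fun j => y k j.+1)
  (@y_inner k) IHk (leqnn T).
by move=> /= ->; rewrite addrC subrK.
Qed.

Section Step.
Variable k : nat.

Local Notation a := (l2norm (mean (x k 1%N) - xs)).
Local Notation b := (l2norm (deviation (x k 1%N))).
Local Notation c := (l2norm (deviation (y k 1%N))).
Local Notation X := (fun j : nat => x k j.+1).
Local Notation Y := (fun j : nat => y k j.+1).
Local Notation S := (total_error L xs X Y).

Let S_ge0 : 0 <= S.
Proof. exact: (total_error_ge0 xs mu_gt0 mu_le_L X Y). Qed.

Let p_ge0 (W : 'M[R]_n) : 0 <= p W.
Proof. by rewrite exprn_ge0 // op2norm_ge0. Qed.

Let tG_lt1 : alpha * L * G < 1.
Proof. by move: alphaL_lt1; rewrite [_ * L]mulrC mulrA. Qed.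

Let devX : l2norm (deviation (x k T.+1)) <= b + alpha * (T%:R * c + alpha * L * (T%:R * (T%:R - 1)) * S).
Proof.
exact: (deviation_X_bound (X := X) (Y := Y) n_gt0 fs_diff fs_lip mu_gt0 mu_le_L
  f_sc xs_min alpha_gt0 alphaL_lt1 (@x_inner k) (@y_inner k) (mean_y_tracks k) (leqnn T)).
Qed.

Let devX' : l2norm (deviation (x k T.+1)) <= b + 2 * alpha * T%:R * S.
Proof.
exact: (deviation_X_bound_linear (X := X) (Y := Y) n_gt0 fs_diff fs_lip mu_gt0 mu_le_L
  f_sc xs_min alpha_gt0 alphaL_lt1 (@x_inner k) (@y_inner k) (mean_y_tracks k) (leqnn T)).
Qed.

Let devY : l2norm (deviation (y k T.+1)) <= c + 2 * (T%:R * (alpha * L)) * S.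
Proof.
exact: (deviation_Y_bound (X := X) (Y := Y) n_gt0 fs_diff fs_lip mu_gt0 mu_le_L
  f_sc xs_min alpha_gt0 alphaL_lt1 (@x_inner k) (@y_inner k) (mean_y_tracks k) (leqnn T)).
Qed.

Let normY : l2norm (y k T.+1) <= (1 + 2 * (T%:R * (alpha * L))) * S.
Proof.
by case: (gradient_growth_linear (X := X) (Y := Y) n_gt0 fs_diff fs_lip mu_gt0 mu_le_L
  f_sc xs_min alpha_gt0 alphaL_lt1 (@x_inner k) (@y_inner k) (mean_y_tracks k) (leqnn T)).
Qed.

(** First row of the error matrix. The last local step and the communication are
    one update, and the mean sees only the former. *)
Lemma optimality_error_step :
  l2norm (mean (x k.+1 1%N) - xs) <= mean_bound alpha mu L xs X Y T.+1.
Proof.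
case: xy_gt => _ _ xS _; rewrite xS meanB meanZ !mean_exp_kron //.
have H := (mean_error_bound (X := X) (Y := Y) n_gt0 fs_diff fs_lip mu_gt0 mu_le_L
  f_sc xs_min alpha_gt0 alphaL_lt1 (@x_inner k) (@y_inner k) (mean_y_tracks k) (leqnn T)).
exact: (mean_bound_step (X := X) (Y := Y) n_gt0 fs_diff fs_lip mu_gt0 mu_le_L
  f_sc xs_min alpha_gt0 alphaL_lt1 (@x_inner k) (@y_inner k) (mean_y_tracks k) (leqnn T) H).
Qed.

(** Second row of the error matrix: mixing shrinks the disagreement that local
    steps have accumulated. *)
Lemma consensus_error_step :
  l2norm (deviation (x k.+1 1%N)) <=
  p W1 * b + alpha * (T%:R * p W1 + p W2) * c + alpha * L * T%:R * (alpha * delta1' * S).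
Proof.
case: xy_gt => _ _ xS _; rewrite xS deviationB deviationZ.
apply: le_trans (l2normB _ _) _; rewrite l2normZ gtr0_norm //.
have h1 := l2norm_deviation_exp_kron n_gt0 ds1 nc (x k T.+1).
have h2 := l2norm_deviation_exp_kron n_gt0 ds2 nc (y k T.+1).
have h3 := ler_wpM2l (p_ge0 W1) devX.
have h4 := ler_wpM2l (p_ge0 W2) devY.
have h5 := ler_wpM2l (ltW alpha_gt0) (le_trans h2 h4).
rewrite /delta1 -[G]natr1; move: h1 h3 h5.
by move: S => S'; lra.
Qed.

(** Third row of the error matrix. Moving from [x k T.+1] to [x k.+1 1] is a mixing
    step on disagreement, whose size [zeta] measures, and a step along the tracked
    gradient. *)
Lemma tracking_error_step :
  l2norm (deviation (y k.+1 1%N)) <=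
  p W4 * L * zeta * b + p W3 * c + alpha * L * p W4 * S
    + alpha * L * T%:R * (delta2' * S).
Proof.
case: xy_gt => _ _ xS yS; rewrite yS deviationD.
apply: le_trans (l2normD _ _) _.
have h1 := le_trans (l2norm_deviation_exp_kron n_gt0 ds3 nc (y k T.+1))
  (ler_wpM2l (p_ge0 W3) devY).
have h2 : l2norm (F (x k.+1 1%N) - F (x k T.+1)) <=
    L * (zeta * (b + 2 * alpha * T%:R * S) + alpha * ((1 + 2 * (T%:R * (alpha * L))) * S)).
  apply: le_trans (l2norm_stacked_grad (ltW L_gt0) fs_lip _ _) _.
  rewrite ler_pM2l // xS.
  have -> : Z W1 *m x k T.+1 - alpha *: (Z W2 *m y k T.+1) - x k T.+1
      = (Z W1 - 1%:M) *m deviation (x k T.+1) - alpha *: (Z W2 *m y k T.+1).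
    rewrite mulmxBl mul1mx -deviation_exp_kron // addrAC -deviationB.
    by rewrite deviation_mean0 // meanB mean_exp_kron // subrr.
  apply: le_trans (l2normB _ _) _; rewrite l2normZ gtr0_norm //; apply: lerD.
    apply: le_trans (op2norm_bound _ _) _.
    by rewrite ler_wpM2l ?op2norm_ge0 ?devX'.
  rewrite ler_pM2l //; apply: le_trans normY.
  exact: l2norm_exp_kron.
have h3 := le_trans (l2norm_deviation_exp_kron n_gt0 ds4 nc (F (x k.+1 1%N) - F (x k T.+1)))
  (ler_wpM2l (p_ge0 W4) (le_trans (l2norm_deviation n_gt0 _) h2)).
apply: le_trans (lerD h1 h3) _.
(* The summand p4 / G of delta2 pays for the growth of the gradients in the last
   step; the loss is the factor alpha * L * G < 1. *)
have key : p W4 * L * alpha * (2 * (T%:R * (alpha * L))) * S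
    <= alpha * L * T%:R * (2 * (p W4 / G) * S).
  have -> : p W4 * L * alpha * (2 * (T%:R * (alpha * L))) * S
      = alpha * L * T%:R * (2 * (p W4 / G) * S) * (alpha * L * G).
    by field; rewrite gt_eqF.
  apply: ler_piMr; last exact: (ltW tG_lt1).
  by rewrite !mulr_ge0 ?invr_ge0 // ?(ltW alpha_gt0) ?(ltW L_gt0).
rewrite /delta2; move: key; move: S (p W4 / G) => S' q; lra.
Qed.

End Step.

Lemma error_vector_step k i :
  error_vector xs x y k.+1 i 0
    <= (B_mx d nc T.+1 alpha mu L W1 W2 W3 W4 *m error_vector xs x y k) i 0.
Proof.
have s_neq0 : s != 0 by rewrite gt_eqF // sqrtr_gt0 ltr0n.
have mu_neq0 : mu != 0 by rewrite gt_eqF.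
have G1 : G - 1 = T%:R by rewrite -natr1 addrK.
rewrite [leRHS]mxE sum_ord3; elim/ord3_ind: i; rewrite !mxE /= ?G1.
- apply: le_trans (optimality_error_step k) _.
  rewrite /mean_bound /total_error G1 /deviation le_eqVlt; apply/orP; left; apply/eqP.
  by move: (_ ^+ T.+1) => q; field; rewrite s_neq0.
- apply: le_trans (consensus_error_step k) _.
  rewrite /total_error /deviation; move: (delta1 _ _ _ _) => D; lra.
- apply: le_trans (tracking_error_step k) _.
  rewrite /total_error /deviation; move: (delta2 _ _ _ _ _ _) => D; lra.
Qed.

End OuterStep.

(** * Nonnegative matrices of order three and their spectral radius *)

Section SpectralRadius.
Variable R : realType.
Local Open Scope complex_scope.

(** Collatz-Wielandt bound: pair the moduli of the entries of a left eigenvector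
    with the positive vector [v]. *)
Lemma eigenvalue_bound m (M : 'M[R]_m) (v : 'I_m -> R) (c : R) z :
  (forall i j, 0 <= M i j) -> (forall i, 0 < v i) ->
  (forall i, \sum_j M i j * v j <= c * v i) ->
  eigenvalue (map_mx (real_complex R) M) z -> complex.Re `|z| <= c.
Proof.
move=> M_ge0 v_gt0 Mv /eigenvalueP [w wM w_neq0].
have real_ge0 (a : R) : 0 <= a -> 0 <= a%:C by move=> a0; rewrite lecR.
suff : `|z| <= c%:C by rewrite lecE => /andP [].
have entry j : `|z| * `|w 0 j| <= \sum_i `|w 0 i| * (M i j)%:C.
  have /matrixP /(_ 0 j) := wM; rewrite !mxE -normrM => <-.
  apply: le_trans (ler_norm_sum _ _ _) _; apply: ler_sum => i _.
  by rewrite normrM mxE [X in _ * X]ger0_norm // real_ge0.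
have wv_gt0 : 0 < \sum_j `|w 0 j| * (v j)%:C.
  have term_ge0 j : 0 <= `|w 0 j| * (v j)%:C by rewrite mulr_ge0 // real_ge0 // ltW.
  rewrite lt_neqAle sumr_ge0 // andbT eq_sym; apply: contraNneq w_neq0 => sum0.
  apply/eqP/matrixP => i j; rewrite (ord1 i) mxE.
  have /eqP := sum0; rewrite psumr_eq0 // => /allP /(_ j).
  rewrite mem_index_enum => /(_ isT) /=; rewrite mulf_eq0 normr_eq0.
  by case/orP => /eqP // /complexI vj0; have := v_gt0 j; rewrite vj0 ltxx.
rewrite -(ler_pM2r wv_gt0) mulr_sumr.
apply: (@le_trans _ _ (\sum_j (\sum_i `|w 0 i| * (M i j)%:C) * (v j)%:C)).
  by apply: ler_sum => j _; rewrite mulrA ler_wpM2r ?entry // real_ge0 // ltW.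
under eq_bigr do rewrite mulr_suml.
rewrite exchange_big /= mulr_sumr; apply: ler_sum => i _.
under eq_bigr do rewrite -mulrA -rmorphM.
rewrite -mulr_sumr -rmorph_sum [leRHS]mulrCA.
by apply: ler_wpM2l => //; rewrite -rmorphM lecR.
Qed.

(** The strict inequality leaves room for a constant below [lam], which bounds all
    eigenvalues and hence their supremum. *)
Lemma spectral_radius_lt m (M : 'M[R]_m) (v : 'I_m -> R) (lam : R) :
  0 < lam -> (forall i j, 0 <= M i j) -> (forall i, 0 < v i) ->
  (forall i, \sum_j M i j * v j < lam * v i) -> spectral_radius M < lam.
Proof.
move=> lam_gt0 M_ge0 v_gt0 Mv.
pose c := \big[Num.max/0]_i ((\sum_j M i j * v j) / v i).
have c_lt : c < lam by apply: bigmax_lt => // i _; rewrite ltr_pdivrMr.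
apply: le_lt_trans c_lt; rewrite /spectral_radius; set A := (X in sup X).
have [A0|/set0P/negP/negPn/eqP ->] := pselect (A !=set0)%classic; last first.
  by rewrite sup0 bigmax_ge_id.
apply: ge_sup => // _ [z /= Mz <-]; apply: eigenvalue_bound Mz => // i.
by rewrite -ler_pdivrMr // /c; exact: le_bigmax.
Qed.

(** The sum of all entries of [M] bounds the moduli of its eigenvalues, so the
    supremum is an upper bound. *)
Lemma le_spectral_radius m (M : 'M[R]_m) (lam : R) :
  (forall i j, 0 <= M i j) -> root (char_poly M) lam -> lam <= spectral_radius M.
Proof.
move=> M_ge0 Mlam; apply: (@le_trans _ _ `|lam|); first exact: ler_norm.
apply: ub_le_sup.
  exists (\sum_i \sum_j M i j) => _ [z /= Mz <-].
  apply: (eigenvalue_bound (v := fun=> 1)) Mz => // i.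
  rewrite /= mulr1; under eq_bigr do rewrite mulr1.
  rewrite [leRHS](bigD1 i) //= lerDl.
  by apply: sumr_ge0 => k _; apply: sumr_ge0.
exists lam%:C => /=; last by rewrite expr0n /= addr0 sqrtr_sqr.
rewrite eigenvalue_root_char -map_char_poly /=.
by rewrite fmorph_root.
Qed.

Lemma det3E (K : comNzRingType) (A : 'M[K]_3) :
  \det A = A o0 o0 * (A o1 o1 * A o2 o2 - A o1 o2 * A o2 o1)
    - A o0 o1 * (A o1 o0 * A o2 o2 - A o1 o2 * A o2 o0)
    + A o0 o2 * (A o1 o0 * A o2 o1 - A o1 o1 * A o2 o0).
Proof.
have [a aE] : exists a : nat -> nat -> K, forall i j, A i j = a i j.
  by exists (fun i j => A (inord i) (inord j)) => i j; rewrite !inord_val.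
rewrite (expand_det_row _ ord0) !big_ord_recl big_ord0 /cofactor.
rewrite !(expand_det_row _ ord0) !big_ord_recl !big_ord0 /cofactor !det_mx11 !mxE.
by rewrite !aE /= /bump /=; ring.
Qed.

(** The determinant of [lam%:M - M], expanded so that every term but the leading
    product of the diagonal is the opposite of a product of factors that are
    nonnegative when [M] is and its diagonal is at most [lam]. *)
Definition det_shift (M : 'M[R]_3) (lam : R) : R :=
  (lam - M o0 o0) * ((lam - M o1 o1) * (lam - M o2 o2) - M o1 o2 * M o2 o1)
  - (lam - M o2 o2) * (M o0 o1 * M o1 o0) - (lam - M o1 o1) * (M o0 o2 * M o2 o0)
  - M o0 o1 * M o1 o2 * M o2 o0 - M o0 o2 * M o1 o0 * M o2 o1.

Lemma horner_char_poly3 (M : 'M[R]_3) lam : (char_poly M).[lam] = det_shift M lam.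
Proof.
by rewrite /char_poly det3E !mxE /= !hornerE /det_shift; ring.
Qed.

(** The vector is [adj (lam%:M - M) *m 1], which [lam%:M - M] maps to [det 1]. The
    off-diagonal entries of the adjugate are sums of nonnegative products, and the
    diagonal ones are principal minors, positive because each of them times the
    remaining diagonal entry is at least the determinant. *)
Lemma det_shift_gt0_subinvariant (M : 'M[R]_3) lam :
  (forall i j, 0 <= M i j) -> (forall i, M i i < lam) -> 0 < det_shift M lam ->
  exists v : 'I_3 -> R, (forall i, 0 < v i) /\ forall i, \sum_j M i j * v j < lam * v i.
Proof.
move=> M_ge0 diag det_gt0.
have [d0 d1 d2] : [/\ 0 < lam - M o0 o0, 0 < lam - M o1 o1 & 0 < lam - M o2 o2].
  by split; rewrite subr_gt0.
have [c1 c2] : 0 <= M o0 o1 * M o1 o2 * M o2 o0 /\ 0 <= M o0 o2 * M o1 o0 * M o2 o1.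
  by rewrite !mulr_ge0.
have pos i j k l : 0 <= M i j * M k l by rewrite mulr_ge0.
have [e0 e1 e2] : [/\ 0 <= (lam - M o0 o0) * (M o1 o2 * M o2 o1),
    0 <= (lam - M o1 o1) * (M o0 o2 * M o2 o0)
    & 0 <= (lam - M o2 o2) * (M o0 o1 * M o1 o0)].
  by split; rewrite mulr_ge0 // ltW.
move: det_gt0; rewrite /det_shift => det_gt0.
have m12 : 0 < (lam - M o1 o1) * (lam - M o2 o2) - M o1 o2 * M o2 o1.
  by rewrite -(pmulr_rgt0 _ d0); lra.
have m02 : 0 < (lam - M o0 o0) * (lam - M o2 o2) - M o0 o2 * M o2 o0.
  by rewrite -(pmulr_rgt0 _ d1); lra.
have m01 : 0 < (lam - M o0 o0) * (lam - M o1 o1) - M o0 o1 * M o1 o0.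
  by rewrite -(pmulr_rgt0 _ d2); lra.
have dM0 i j := mulr_ge0 (ltW d0) (M_ge0 i j).
have dM1 i j := mulr_ge0 (ltW d1) (M_ge0 i j).
have dM2 i j := mulr_ge0 (ltW d2) (M_ge0 i j).
exists (fun i => nth 0
  [:: (lam - M o1 o1) * (lam - M o2 o2) - M o1 o2 * M o2 o1
      + (M o0 o1 * (lam - M o2 o2) + M o0 o2 * M o2 o1)
      + (M o0 o1 * M o1 o2 + M o0 o2 * (lam - M o1 o1));
      M o1 o0 * (lam - M o2 o2) + M o1 o2 * M o2 o0
      + ((lam - M o0 o0) * (lam - M o2 o2) - M o0 o2 * M o2 o0)
      + ((lam - M o0 o0) * M o1 o2 + M o0 o2 * M o1 o0);
      M o1 o0 * M o2 o1 + (lam - M o1 o1) * M o2 o0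
      + ((lam - M o0 o0) * M o2 o1 + M o0 o1 * M o2 o0)
      + ((lam - M o0 o0) * (lam - M o1 o1) - M o0 o1 * M o1 o0)] i).
split; apply: ord3_ind; rewrite ?sum_ord3 /=.
- have := dM2 o0 o1; have := dM1 o0 o2.
  by have := pos o0 o2 o2 o1; have := pos o0 o1 o1 o2; lra.
- have := dM2 o1 o0; have := dM0 o1 o2.
  by have := pos o1 o2 o2 o0; have := pos o0 o2 o1 o0; lra.
- have := dM1 o2 o0; have := dM0 o2 o1.
  by have := pos o1 o0 o2 o1; have := pos o0 o1 o2 o0; lra.
- by rewrite -subr_gt0; lra.
- by rewrite -subr_gt0; lra.
- by rewrite -subr_gt0; lra.
Qed.

(** Beyond the spectral radius the characteristic polynomial has no real root, so it
    is positive there. This forces the diagonal below [lam]: at the largest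
    diagonal entry the leading product of [det_shift] vanishes and the determinant
    is nonpositive. A substitute for a Perron vector, at the price of an
    arbitrarily small increase of the rate. *)
Lemma subinvariant_above_spectral_radius (M : 'M[R]_3) lam :
  (forall i j, 0 <= M i j) -> spectral_radius M < lam ->
  exists v : 'I_3 -> R, (forall i, 0 < v i) /\ forall i, \sum_j M i j * v j < lam * v i.
Proof.
move=> M_ge0 rho_lt.
have det_gt0 lam' : lam <= lam' -> 0 < det_shift M lam'.
  move=> lam_le; rewrite -horner_char_poly3 -sgr_cp0.
  have noroots : {in `[lam', +oo[, forall t, ~~ root (char_poly M) t}.
    move=> t; rewrite in_itv /= andbT => t_ge; apply/negP => /(le_spectral_radius M_ge0).
    by apply/negP; rewrite -ltNge (lt_le_trans rho_lt) // (le_trans lam_le).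
  rewrite (polyrcf.sgp_pinftyP noroots) ?in_itv /= ?lexx //.
  by rewrite /polyrcf.sgp_pinfty (monicP (char_poly_monic M)) sgr1.
apply: det_shift_gt0_subinvariant => //; last exact: det_gt0.
case: (arg_maxP (fun i => M i i) (i0 := o0) (P := xpredT)) => // i0 _ i0_max i.
apply: le_lt_trans (i0_max i isT) _; rewrite ltNge; apply/negP => /det_gt0.
apply/negP; rewrite -leNgt.
have [h0 h1 h2] : [/\ 0 <= M i0 i0 - M o0 o0, 0 <= M i0 i0 - M o1 o1 & 0 <= M i0 i0 - M o2 o2].
  by split; rewrite subr_ge0; exact: i0_max.
have pos i' j k l : 0 <= M i' j * M k l by rewrite mulr_ge0.
have c1 : 0 <= M o0 o1 * M o1 o2 * M o2 o0 by rewrite !mulr_ge0.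
have c2 : 0 <= M o0 o2 * M o1 o0 * M o2 o1 by rewrite !mulr_ge0.
have e0 := mulr_ge0 h0 (pos o1 o2 o2 o1).
have e1 := mulr_ge0 h1 (pos o0 o2 o2 o0).
have e2 := mulr_ge0 h2 (pos o0 o1 o1 o0).
have dd0 : (M i0 i0 - M o0 o0) * ((M i0 i0 - M o1 o1) * (M i0 i0 - M o2 o2)) = 0.
  by move: {+}i0; apply: ord3_ind; rewrite subrr ?(mul0r, mulr0).
by rewrite /det_shift; lra.
Qed.

(** The multiples [K * lam ^+ k] of [v] dominate [r k]: for [k = 0] because [v] is
    positive, and then because the nonnegative [M] preserves domination and maps
    [v] below [lam * v]. *)
Lemma geometric_decay m (M : 'M[R]_m) (v : 'I_m -> R) lam (r : nat -> 'cV[R]_m) :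
  0 <= lam -> (forall i j, 0 <= M i j) -> (forall i, 0 < v i) ->
  (forall i, \sum_j M i j * v j <= lam * v i) ->
  (forall k i, 0 <= r k i 0) -> (forall k i, r k.+1 i 0 <= (M *m r k) i 0) ->
  exists C, 0 < C /\ forall k, l2norm (r k) <= C * lam ^+ k * l2norm (r 0%N).
Proof.
move=> lam_ge0 M_ge0 v_gt0 Mv r_ge0 r_step.
have iv_gt0 i : 0 < (v i)^-1 by rewrite invr_gt0.
pose w : 'cV[R]_m := \col_i v i.
pose c := \sum_i (v i)^-1.
have c_ge0 : 0 <= c by apply: sumr_ge0 => i _; exact: ltW.
(* The summand 1 keeps the constant positive when m = 0. *)
exists (c * l2norm w + 1); split; first by rewrite ltr_wpDl // mulr_ge0 // l2norm_ge0.
move=> k; set K := c * l2norm (r 0%N).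
have K_ge0 : 0 <= K by rewrite mulr_ge0 // l2norm_ge0.
have bound i : r k i 0 <= K * lam ^+ k * v i.
  elim: k i => [|k IHk] i.
    rewrite expr0 mulr1 -ler_pdivrMr // mulrC.
    apply: (@le_trans _ _ ((v i)^-1 * l2norm (r 0%N))).
      rewrite ler_pM2l //; rewrite -[leLHS]ger0_norm // -sqrtr_sqr.
      apply: ler_wsqrtr; rewrite (bigD1 i) //= lerDl.
      by apply: sumr_ge0 => j _; exact: sqr_ge0.
    rewrite ler_wpM2r ?l2norm_ge0 // /c (bigD1 i) //= lerDl.
    by apply: sumr_ge0 => j _; exact: ltW.
  apply: le_trans (r_step k i) _; rewrite mxE.
  apply: (@le_trans _ _ (\sum_j M i j * (K * lam ^+ k * v j))).
    by apply: ler_sum => j _; rewrite ler_wpM2l.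
  under eq_bigr do rewrite mulrCA.
  rewrite -mulr_sumr.
  have -> : K * lam ^+ k.+1 * v i = K * lam ^+ k * (lam * v i) by rewrite exprSr; ring.
  by rewrite ler_wpM2l // mulr_ge0 // exprn_ge0.
apply: (@le_trans _ _ (K * lam ^+ k * l2norm w)).
  have Kl_ge0 : 0 <= K * lam ^+ k by rewrite mulr_ge0 // exprn_ge0.
  rewrite -[K * lam ^+ k]ger0_norm // -l2normZ; apply: ler_wsqrtr.
  apply: ler_sum => i _; rewrite ler_sqr ?nnegrE //; first by rewrite !mxE.
  by rewrite !mxE mulr_ge0 // ltW.
have -> : K * lam ^+ k * l2norm w = c * l2norm w * lam ^+ k * l2norm (r 0%N).
  by rewrite /K; ring.
rewrite ler_wpM2r ?l2norm_ge0 // ler_wpM2r ?exprn_ge0 //.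
by rewrite lerDl.
Qed.
End SpectralRadius.

(** * The step size and the determinant of 1 - B *)

(** Bernoulli's inequality and its second order counterpart: together they locate
    the contraction factor of several gradient steps. *)
Lemma exp_1B_ge (R : realFieldType) (t : R) j :
  0 <= t -> t <= 1 -> 1 - j%:R * t <= (1 - t) ^+ j.
Proof.
move=> t_ge0 t_le1; elim: j => [|j IHj]; first by rewrite mul0r subr0 expr0.
have t1_ge0 : 0 <= 1 - t by rewrite subr_ge0.
rewrite exprS; apply: le_trans (ler_wpM2l t1_ge0 IHj).
rewrite -[j.+1%:R]natr1.
by have := mulr_ge0 (ler0n R j) (mulr_ge0 t_ge0 t_ge0); lra.
Qed.

Lemma exp_1B_le (R : realFieldType) (t : R) j : 0 <= t -> t <= 1 ->
  (1 - t) ^+ j <= 1 - j%:R * t + j%:R * (j%:R - 1) / 2 * t ^+ 2.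
Proof.
move=> t_ge0 t_le1; elim: j => [|j IHj]; first by rewrite expr0 !mul0r subr0 addr0.
have t1_ge0 : 0 <= 1 - t by rewrite subr_ge0.
rewrite exprS; apply: le_trans (ler_wpM2l t1_ge0 IHj) _.
rewrite -[j.+1%:R]natr1.
have jj : 0 <= j%:R * (j%:R - 1) :> R.
  by case: (j) => [|i]; rewrite ?mul0r // mulr_ge0 // subr_ge0 ler1n.
by have := mulr_ge0 jj (exprn_ge0 3 t_ge0); rewrite !exprS expr0; lra.
Qed.

(** Positivity of a determinant [d1 d2 d3 - d1 t1 - d2 t2 - d3 t3 - t4] can be
    checked at lower bounds for the [d]'s: it forces the coefficient of each of
    them to be positive, so they can be raised one after the other. *)
Lemma det_lower_bound (R : realFieldType) (d1 d2 d3 e1 e2 e3 t1 t2 t3 t4 : R) :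
  0 < e1 -> 0 < e2 -> 0 < e3 -> e1 <= d1 -> e2 <= d2 -> e3 <= d3 ->
  0 <= t1 -> 0 <= t2 -> 0 <= t3 -> 0 <= t4 ->
  e1 * t1 + e2 * t2 + e3 * t3 + t4 < e1 * e2 * e3 ->
  d1 * t1 + d2 * t2 + d3 * t3 + t4 < d1 * d2 * d3.
Proof.
move=> e1_gt0 e2_gt0 e3_gt0 de1 de2 de3 t1_ge0 t2_ge0 t3_ge0 t4_ge0 He.
have et1 := mulr_ge0 (ltW e1_gt0) t1_ge0.
have et2 := mulr_ge0 (ltW e2_gt0) t2_ge0.
have et3 := mulr_ge0 (ltW e3_gt0) t3_ge0.
have k1 : t1 < e2 * e3 by rewrite -(ltr_pM2l e1_gt0); lra.
have H1 : d1 * t1 + e2 * t2 + e3 * t3 + t4 < d1 * e2 * e3.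
  have : 0 <= (d1 - e1) * (e2 * e3 - t1) by rewrite mulr_ge0 // subr_ge0 // ltW.
  by lra.
have d1_gt0 := lt_le_trans e1_gt0 de1.
have dt1 := mulr_ge0 (ltW d1_gt0) t1_ge0.
have k2 : t2 < d1 * e3 by rewrite -(ltr_pM2l e2_gt0); lra.
have H2 : d1 * t1 + d2 * t2 + e3 * t3 + t4 < d1 * d2 * e3.
  have : 0 <= (d2 - e2) * (d1 * e3 - t2) by rewrite mulr_ge0 // subr_ge0 // ltW.
  by lra.
have d2_gt0 := lt_le_trans e2_gt0 de2.
have dt2 := mulr_ge0 (ltW d2_gt0) t2_ge0.
have k3 : t3 < d1 * d2 by rewrite -(ltr_pM2l e3_gt0); lra.
have : 0 <= (d3 - e3) * (d1 * d2 - t3) by rewrite mulr_ge0 // subr_ge0 // ltW.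
by lra.
Qed.

(** A fraction with denominator [0] stands for [+oo] and gives no constraint. *)
Lemma lt_frac_oo (R : realType) (a b t : R) :
  0 <= b -> (t%:E < frac_oo a b)%E -> b = 0 \/ 0 < b /\ t * b < a.
Proof.
move=> b_ge0; rewrite /frac_oo; case: eqVneq => [->|b_neq0]; first by left.
have b_gt0 : 0 < b by rewrite lt_neqAle eq_sym b_neq0.
by rewrite lte_fin ltr_pdivlMr //; right.
Qed.

Section StepSize.
Variables (R : realType) (n d nc T : nat) (alpha mu L : R).
Variables W1 W2 W3 W4 : 'M[R]_n.
Hypothesis n_gt0 : (0 < n)%N.
Hypothesis mu_gt0 : 0 < mu.
Hypothesis mu_le_L : mu <= L.
Hypothesis alpha_gt0 : 0 < alpha.
Hypothesis ds1 : doubly_stochastic W1.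
Hypothesis nc_gt0 : (0 < nc)%N.
Hypothesis beta1_lt1 : beta W1 < 1.
Hypothesis beta3_lt1 : beta W3 < 1.
Hypothesis alpha_small : (alpha%:E < step_bound d nc T.+1 mu L W1 W2 W3 W4)%E.

Local Notation s := (Num.sqrt (n%:R : R)).
Local Notation p1 := (beta W1 ^+ nc).
Local Notation p2 := (beta W2 ^+ nc).
Local Notation p3 := (beta W3 ^+ nc).
Local Notation p4 := (beta W4 ^+ nc).
Local Notation zeta := (op2norm (kron_id d W1 ^+ nc - 1%:M)).
Local Notation G := (T.+1%:R : R).
Local Notation t := (T%:R : R).
Local Notation D1 := (t * delta1 nc T.+1 W1 W2).
Local Notation D2 := (t * delta2 d nc T.+1 W1 W3 W4).
Local Notation e2 := ((1 - p1) / 4).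
Local Notation e3 := ((1 - p3) / 4).
Local Notation P := (t * p1 + D1 + p2).
Local Notation Q := (p4 + D2).
Local Notation B := (B_mx d nc T.+1 alpha mu L W1 W2 W3 W4).

Let L_gt0 : 0 < L. Proof. exact: lt_le_trans mu_le_L. Qed.
Let s_gt0 : 0 < s. Proof. by rewrite sqrtr_gt0 ltr0n. Qed.
Let p_ge0 (W : 'M[R]_n) : 0 <= beta W ^+ nc.
Proof. by rewrite exprn_ge0 // op2norm_ge0. Qed.
Let p_lt1 (W : 'M[R]_n) : beta W < 1 -> beta W ^+ nc < 1.
Proof. by move=> W_lt1; rewrite exprn_ilt1 ?op2norm_ge0 // -lt0n. Qed.
Let zeta_ge0 : 0 <= zeta. Proof. exact: op2norm_ge0. Qed.
Let zeta_le2 : zeta <= 2. Proof. exact: op2norm_exp_kronB1. Qed.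
Let t_ge0 : 0 <= t. Proof. exact: ler0n. Qed.
Let G_gt0 : 0 < G. Proof. by rewrite ltr0n. Qed.
Let G1 : G - 1 = t. Proof. by rewrite -natr1 addrK. Qed.
Let e2_gt0 : 0 < e2. Proof. by rewrite divr_gt0 // subr_gt0 p_lt1. Qed.
Let e3_gt0 : 0 < e3. Proof. by rewrite divr_gt0 // subr_gt0 p_lt1. Qed.

Let delta2_ge0 : 0 <= delta2 d nc T.+1 W1 W3 W4.
Proof.
by rewrite mulr_ge0 // !addr_ge0 ?mulr_ge0 ?invr_ge0 //; exact: ltW.
Qed.

Let D1_ge0 : 0 <= D1.
Proof.
rewrite /delta1; case: (T) => [|i]; first by rewrite mul0r.
by rewrite mulr_ge0 // addr_ge0 ?mulr_ge0 // subr_ge0 ler_nat.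
Qed.

Let D2_ge0 : 0 <= D2. Proof. exact: mulr_ge0. Qed.
Let P_ge0 : 0 <= P. Proof. by rewrite addr_ge0 // addr_ge0 // mulr_ge0. Qed.
Let Q_ge0 : 0 <= Q. Proof. by rewrite addr_ge0. Qed.

(** Here [t] is the number of local steps before the last one; [D1], [D2], [P] and
    [Q] are nonnegative even for [t = 0], when [delta1] may be negative. *)
Lemma b1E : b1 d nc T.+1 mu L W1 W2 W3 W4 =
  mu * L ^+ 2 * G / 2 * P * Q + L ^+ 3 * G * (D1 * e3 + t * Q * e2)
  + L ^+ 2 * t * (L * D1 * (3 * p4 + D2) + D1 * e3) + L ^+ 2 * Q * (L * G + t) * P.
Proof. by rewrite /b1 G1; ring. Qed.

Lemma b2E : b2 nc T.+1 mu L W1 W2 W4 = mu * G * p4 * L * P.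
Proof. by rewrite /b2 G1; ring. Qed.

Lemma step_size_lt1 : alpha * (G * L) < 1.
Proof.
move: alpha_small; rewrite /step_bound lt_min => /andP [/lt_frac_oo H _].
case: H => [|/eqP|[]//]; first by rewrite mulr_ge0 // ltW.
by rewrite mulf_eq0 gt_eqF //= gt_eqF.
Qed.

Let aG_le1 : alpha * L * G <= 1.
Proof. by move: step_size_lt1 => /ltW; rewrite [G * L]mulrC mulrA. Qed.

Let a_gt0 : 0 < alpha * L. Proof. exact: mulr_gt0. Qed.

Let aG_split : alpha * L * t + alpha * L <= 1.
Proof. by move: aG_le1; rewrite -[G]natr1 mulrDr mulr1. Qed.

Lemma step_size_descent : alpha * ((2 * L ^+ 2 + mu ^+ 2) * t) <= mu.
Proof.
move: alpha_small; rewrite /step_bound !lt_min => /and5P [_ /lt_frac_oo H _ _ _].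
have c_gt0 : 0 < 2 * L ^+ 2 + mu ^+ 2 by rewrite addr_gt0 ?mulr_gt0 ?exprn_gt0.
move: H; rewrite G1 => H; case: H => [|->|[_ /ltW //]].
  by rewrite mulr_ge0 // ltW.
by rewrite mulr0 ltW.
Qed.

Lemma step_size_tracking : alpha * (4 * L * Q) <= 3 * (1 - p3).
Proof.
move: alpha_small; rewrite /step_bound !lt_min => /and5P [_ _ _ /lt_frac_oo H _].
move: H; rewrite G1 [delta2 _ _ _ _ _ _ * t]mulrC => H; case: H => [|->|[_ /ltW //]].
  by rewrite !mulr_ge0 // ltW.
by move: e3_gt0; lra.
Qed.

(** The last bound on the step size is the positive root of
    [b1 X^2 + b2 X - b3], except if [b1 = 0]; then one of [P] and [Q] vanishes,
    hence [b2] does too, and only [b3 > 0] remains. *)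
Lemma step_size_quadratic :
  alpha ^+ 2 * b1 d nc T.+1 mu L W1 W2 W3 W4 + alpha * b2 nc T.+1 mu L W1 W2 W4
    < mu * G / 2 * e2 * e3.
Proof.
have b3_gt0 : 0 < mu * G / 2 * e2 * e3 by rewrite mulr_gt0 // mulr_gt0 // divr_gt0 // mulr_gt0.
have mu_ge0 := ltW mu_gt0; have L_ge0 := ltW L_gt0; have G_ge0 := ltW G_gt0.
have b2_ge0 : 0 <= b2 nc T.+1 mu L W1 W2 W4 by rewrite b2E mulr_ge0 // !mulr_ge0.
have LQGP_ge0 : 0 <= L ^+ 3 * G * (Q * P).
  by rewrite mulr_ge0 ?(mulr_ge0 Q_ge0) // mulr_ge0 // exprn_ge0.
have b1_ge : L ^+ 3 * G * (Q * P) <= b1 d nc T.+1 mu L W1 W2 W3 W4.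
  rewrite b1E -subr_ge0; move: P_ge0 Q_ge0 D1_ge0 D2_ge0 (ltW e2_gt0) (ltW e3_gt0).
  move: P Q => P' Q' P'_ge0 Q'_ge0; move: D1 D2 e2 e3 => x1 x2 y1 y2 x1_ge0 x2_ge0 y1_ge0 y2_ge0.
  rewrite (_ : _ - _ = mu * L ^+ 2 * G / 2 * P' * Q' + L ^+ 3 * G * (x1 * y2 + t * Q' * y1)
    + L ^+ 2 * t * (L * x1 * (3 * p4 + x2) + x1 * y2) + L ^+ 2 * Q' * t * P'); last by ring.
  by rewrite !(addr_ge0, mulr_ge0, invr_ge0, exprn_ge0) // op2norm_ge0.
have b1_ge0 := le_trans LQGP_ge0 b1_ge.
move: alpha_small; rewrite /step_bound !lt_min => /and5P [_ _ _ _ /lt_frac_oo H].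
case: H => [|/eqP|[b1_gt0 H]]; first by rewrite mulr_ge0.
  rewrite mulf_eq0 pnatr_eq0 /= => /eqP b10.
  have : L ^+ 3 * G * (Q * P) == 0 by rewrite eq_le LQGP_ge0 andbT -b10.
  rewrite mulf_eq0 (gt_eqF (mulr_gt0 (exprn_gt0 3 L_gt0) G_gt0)) /= mulf_eq0 => QP0.
  suff -> : b2 nc T.+1 mu L W1 W2 W4 = 0 by rewrite b10 !mulr0 addr0.
  rewrite b2E; case/orP: QP0 => /eqP; last by move=> ->; rewrite mulr0.
  move/eqP; rewrite paddr_eq0 // => /andP [/eqP -> _].
  by rewrite mulr0 !mul0r.
rewrite pmulr_rgt0 // in b1_gt0.
move: H b1_gt0 b2_ge0 b3_gt0; rewrite /b3.
move: (b1 _ _ _ _ _ _ _ _ _) (b2 _ _ _ _ _ _ _) (mu * _ / 2 * _ * _) => c1 c2 c3 H c1_gt0 c2_ge0 c3_gt0.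
have {}H : c2 + alpha * (2 * c1) < Num.sqrt (c2 ^+ 2 + 4 * c1 * c3) by lra.
have H' : (c2 + alpha * (2 * c1)) ^+ 2 < c2 ^+ 2 + 4 * c1 * c3.
  have D_ge0 : 0 <= c2 ^+ 2 + 4 * c1 * c3.
    by rewrite addr_ge0 ?sqr_ge0 // !mulr_ge0 // ltW.
  rewrite -[ltRHS]sqr_sqrtr // ltr_sqr ?nnegrE ?sqrtr_ge0 //.
  by rewrite addr_ge0 // !mulr_ge0 // ltW.
by rewrite -(ltr_pM2l c1_gt0); move: H'; rewrite !exprS expr0; lra.
Qed.

Let am_le1 : alpha * mu <= 1.
Proof.
apply: le_trans (_ : alpha * L <= 1); first by rewrite ler_pM2l.
by have := mulr_ge0 (ltW a_gt0) t_ge0; move: aG_split; lra.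
Qed.

Let q := (1 - alpha * mu) ^+ T.+1.

Let q_ge0 : 0 <= q. Proof. by rewrite exprn_ge0 // subr_ge0. Qed.
Let q_le1 : q <= 1.
Proof.
apply: exprn_ile1; first by rewrite subr_ge0.
by rewrite gerBl mulr_ge0 // ltW.
Qed.

Let mu_ge0 := ltW mu_gt0.
Let L_ge0 := ltW L_gt0.
Let G_ge0 := ltW G_gt0.
Let s_ge0 := ltW s_gt0.
Let alpha_ge0 := ltW alpha_gt0.
Let a_ge0 := ltW a_gt0.
Let s_neq0 : s != 0. Proof. by rewrite gt_eqF. Qed.

Let B00 : B o0 o0 = q + alpha * L * t * (alpha * L * G).
Proof. by rewrite !mxE /= G1. Qed.
Let B01 : B o0 o1 = (L / mu * (1 - q) + alpha * L * t * (alpha * L * G)) / s.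
Proof. by rewrite !mxE /= G1 -/q; field; rewrite s_neq0 gt_eqF. Qed.
Let B02 : B o0 o2 = alpha * L * t * (alpha * G) / s.
Proof. by rewrite !mxE /= G1; field. Qed.
Let B10 : B o1 o0 = s * ((alpha * L) ^+ 2 * D1).
Proof. by rewrite !mxE /= G1; move: (delta1 _ _ _ _) => D; ring. Qed.
Let B11 : B o1 o1 = p1 + (alpha * L) ^+ 2 * D1.
Proof. by rewrite !mxE /= G1; move: (delta1 _ _ _ _) => D; ring. Qed.
Let B12 : B o1 o2 = alpha * (t * p1 + p2 + alpha * L * D1).
Proof. by rewrite !mxE /= G1; move: (delta1 _ _ _ _) => D; ring. Qed.
Let B20 : B o2 o0 = s * (alpha * L ^+ 2 * Q).
Proof. by rewrite !mxE /= G1; move: (delta2 _ _ _ _ _ _) => D; ring. Qed.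
Let B21 : B o2 o1 = p4 * L * zeta + alpha * L * L * Q.
Proof. by rewrite !mxE /= G1; move: (delta2 _ _ _ _ _ _) => D; ring. Qed.
Let B22 : B o2 o2 = p3 + alpha * L * Q.
Proof. by rewrite !mxE /= G1; move: (delta2 _ _ _ _ _ _) => D; ring. Qed.

Lemma B_mx_ge0 i j : 0 <= B i j.
Proof.
have k_ge0 : 0 <= L / mu by rewrite divr_ge0.
have q1_ge0 : 0 <= 1 - q by rewrite subr_ge0.
have aD1_ge0 : 0 <= (alpha * L) ^+ 2 * D1 by rewrite mulr_ge0 // exprn_ge0.
elim/ord3_ind: i; elim/ord3_ind: j.
- by rewrite B00 addr_ge0 // !mulr_ge0.
- by rewrite B01 divr_ge0 // addr_ge0 // mulr_ge0 // mulr_ge0.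
- by rewrite B02 divr_ge0 // mulr_ge0 // mulr_ge0.
- by rewrite B10 mulr_ge0.
- by rewrite B11 addr_ge0.
- by rewrite B12 mulr_ge0 // addr_ge0 ?(mulr_ge0 a_ge0) // addr_ge0 // mulr_ge0.
- by rewrite B20 mulr_ge0 // mulr_ge0 // mulr_ge0 // exprn_ge0.
- by rewrite B21 addr_ge0 ?(mulr_ge0 _ Q_ge0) // ?mulr_ge0 // mulr_ge0.
- by rewrite B22 addr_ge0 // mulr_ge0.
Qed.

(** Second order expansion of the contraction factor; [step_size_descent] says that
    all the quadratic terms together use up at most half of [alpha * mu * G]. *)
Lemma B00_gap : alpha * mu * G / 2 <= 1 - B o0 o0.
Proof.
rewrite B00.
have := exp_1B_le T.+1 (mulr_ge0 alpha_ge0 mu_ge0) am_le1; rewrite -/q G1.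
have := ler_wpM2l (mulr_ge0 alpha_ge0 G_ge0) step_size_descent.
by move: (q) => q'; lra.
Qed.

(** The bound on [B o0 o1] in [B01_le] loses the factor [1 + alpha L t <= 2], for
    which the quadratic condition on the step size makes no allowance: the terms
    with [t] that it does contain carry one power of [L] too few. The loss is
    recovered here, where the gap is at least twice the value [e2] that enters
    [b3]: the term [L^3 G D1 e3] of [b1] shows that [(alpha L)^2 D1 <= e2 / 2]. *)
Lemma B11_gap : 2 * e2 <= 1 - B o1 o1.
Proof.
rewrite B11.
suff : (alpha * L) ^+ 2 * D1 <= e2 / 2 by move: e2_gt0; lra.
have LGe3_gt0 : 0 < L * G * e3 by rewrite mulr_gt0 // mulr_gt0.
rewrite -(ler_pM2r LGe3_gt0).
have h1 : mu * G / 2 * e2 * e3 <= e2 / 2 * (L * G * e3).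
  have := ler_wpM2r (mulr_ge0 (mulr_ge0 G_ge0 (ltW e2_gt0)) (ltW e3_gt0)) mu_le_L.
  by lra.
apply: le_trans h1; apply: le_trans (ltW step_size_quadratic).
rewrite b1E b2E -subr_ge0.
move: P_ge0 Q_ge0 D1_ge0 D2_ge0 (ltW e2_gt0) (ltW e3_gt0).
move: P Q => P' Q' P'_ge0 Q'_ge0.
move: D1 D2 e2 e3 => x1 x2 y1 y2 x1_ge0 x2_ge0 y1_ge0 y2_ge0.
rewrite (_ : _ - _ = alpha ^+ 2 * (mu * L ^+ 2 * G / 2 * P' * Q' + L ^+ 3 * G * (t * Q' * y1)
    + L ^+ 2 * t * (L * x1 * (3 * p4 + x2) + x1 * y2) + L ^+ 2 * Q' * (L * G + t) * P')
    + alpha * (mu * G * p4 * L * P')); last by ring.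
by rewrite !(addr_ge0, mulr_ge0, invr_ge0, exprn_ge0) // op2norm_ge0.
Qed.

Lemma B22_gap : e3 <= 1 - B o2 o2.
Proof. by rewrite B22; move: step_size_tracking; lra. Qed.

Lemma B01_le : s * B o0 o1 <= 2 * (alpha * L * G).
Proof.
have -> : s * B o0 o1 = L / mu * (1 - q) + alpha * L * t * (alpha * L * G).
  by rewrite B01; field; rewrite s_neq0 gt_eqF.
have h1 : L / mu * (1 - q) <= alpha * L * G.
  have -> : alpha * L * G = L / mu * (G * (alpha * mu)) by field; rewrite gt_eqF.
  rewrite ler_wpM2l ?divr_ge0 //.
  by have := exp_1B_ge T.+1 (mulr_ge0 alpha_ge0 mu_ge0) am_le1; rewrite -/q; lra.
have h2 : alpha * L * t * (alpha * L * G) <= 1 * (alpha * L * G).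
  by rewrite ler_wpM2r ?mulr_ge0 //; move: aG_split a_gt0; lra.
by lra.
Qed.

Lemma B12_le : B o1 o2 <= alpha * P.
Proof.
rewrite B12 ler_wpM2l //.
have : alpha * L * D1 <= 1 * D1.
  by rewrite ler_wpM2r //; have := mulr_ge0 a_ge0 t_ge0; move: aG_split; lra.
by lra.
Qed.

Lemma B21_le : B o2 o1 <= L * (2 * p4 + alpha * L * Q).
Proof.
rewrite B21; have := ler_wpM2l (mulr_ge0 (p_ge0 W4) L_ge0) zeta_le2.
by lra.
Qed.

(** Lower bounds for the diagonal of [1 - B] and upper bounds for the products of
    its off-diagonal entries turn positivity of the determinant into twice
    [alpha] times [step_size_quadratic]: the leading product becomes [2 alpha b3]
    and the five subtracted products are bounded by twice the terms of
    [alpha^2 b2 + alpha^3 b1]. *)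
Lemma det_shift_B_gt0 : 0 < det_shift B 1.
Proof.
have Bge := B_mx_ge0.
have u_ge0 : 0 <= s * B o0 o1 by rewrite mulr_ge0.
have aD1_ge0 : 0 <= (alpha * L) ^+ 2 * D1 by rewrite mulr_ge0 // exprn_ge0.
have t1_le : B o1 o2 * B o2 o1 <= alpha * P * (L * (2 * p4 + alpha * L * Q)).
  by apply: ler_pM => //; [exact: B12_le | exact: B21_le].
have t2E : B o0 o2 * B o2 o0 = alpha ^+ 3 * L ^+ 3 * G * t * Q.
  by rewrite B02 B20; move: Q => Q'; field.
have t3_le : B o0 o1 * B o1 o0 <= 2 * (alpha * L * G) * ((alpha * L) ^+ 2 * D1).
  have -> : B o0 o1 * B o1 o0 = s * B o0 o1 * ((alpha * L) ^+ 2 * D1).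
    by rewrite B10; move: (B o0 o1) D1 => ? ?; ring.
  by apply: ler_wpM2r => //; exact: B01_le.
have t4_le : B o0 o1 * B o1 o2 * B o2 o0
    <= 2 * (alpha * L * G) * (alpha * P) * (alpha * L ^+ 2 * Q).
  have -> : B o0 o1 * B o1 o2 * B o2 o0
      = s * B o0 o1 * B o1 o2 * (alpha * L ^+ 2 * Q).
    by rewrite B20; move: (B o0 o1) (B o1 o2) Q => ? ? ?; ring.
  apply: ler_wpM2r; first by rewrite mulr_ge0 // mulr_ge0 // exprn_ge0.
  by apply: ler_pM => //; [exact: B01_le | exact: B12_le].
have t5_le : B o0 o2 * B o1 o0 * B o2 o1
    <= alpha ^+ 3 * L ^+ 3 * t * D1 * (3 * p4 + D2).
  have -> : B o0 o2 * B o1 o0 * B o2 o1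
      = alpha ^+ 3 * L ^+ 2 * t * D1 * (alpha * L * G) * B o2 o1.
    by rewrite B02 B10; move: (B o2 o1) D1 => ? ?; field.
  have w_ge0 : 0 <= alpha ^+ 3 * L ^+ 2 * t * D1.
    by rewrite mulr_ge0 // mulr_ge0 // mulr_ge0 // exprn_ge0.
  have -> : alpha ^+ 3 * L ^+ 3 * t * D1 * (3 * p4 + D2)
      = alpha ^+ 3 * L ^+ 2 * t * D1 * 1 * (L * (3 * p4 + D2)).
    by move: D1 D2 => ? ?; ring.
  apply: ler_pM => //; first by rewrite mulr_ge0 // mulr_ge0.
    by rewrite ler_wpM2l.
  apply: le_trans B21_le _; rewrite ler_pM2l //.
  have : alpha * L * Q <= 1 * Q.
    by rewrite ler_wpM2r //; have := mulr_ge0 a_ge0 t_ge0; move: aG_split; lra.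
  by lra.
have e1_gt0 : 0 < alpha * mu * G / 2 by rewrite !mulr_gt0 ?invr_gt0.
have e2'_gt0 : 0 < 2 * e2 by rewrite mulr_gt0.
have := det_lower_bound e1_gt0 e2'_gt0 e3_gt0 B00_gap B11_gap B22_gap
  (mulr_ge0 (Bge o1 o2) (Bge o2 o1)) (mulr_ge0 (Bge o0 o2) (Bge o2 o0))
  (mulr_ge0 (Bge o0 o1) (Bge o1 o0))
  (addr_ge0 (mulr_ge0 (mulr_ge0 (Bge o0 o1) (Bge o1 o2)) (Bge o2 o0))
            (mulr_ge0 (mulr_ge0 (Bge o0 o2) (Bge o1 o0)) (Bge o2 o1))).
rewrite t2E => H.
suff /H : alpha * mu * G / 2 * (B o1 o2 * B o2 o1)
    + 2 * e2 * (alpha ^+ 3 * L ^+ 3 * G * t * Q) + e3 * (B o0 o1 * B o1 o0)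
    + (B o0 o1 * B o1 o2 * B o2 o0 + B o0 o2 * B o1 o0 * B o2 o1)
    < alpha * mu * G / 2 * (2 * e2) * e3.
  by rewrite -t2E /det_shift; lra.
have h1 := ler_wpM2l (ltW e1_gt0) t1_le.
have h3 := ler_wpM2l (ltW e3_gt0) t3_le.
have := step_size_quadratic; rewrite -(ltr_pM2l alpha_gt0) b1E b2E.
move: h1 h3 t4_le t5_le.
move: (B o0 o1 * B o1 o2 * B o2 o0) (B o0 o2 * B o1 o0 * B o2 o1) => z4 z5.
move: (B o1 o2 * B o2 o1) (B o0 o1 * B o1 o0) => z1 z3.
move: P_ge0 Q_ge0 D1_ge0 D2_ge0 (ltW e2_gt0) (ltW e3_gt0).
move: P Q => P' Q' P'_ge0 Q'_ge0.
move: D1 D2 e2 e3 => x1 x2 y1 y2 x1_ge0 x2_ge0 y1_ge0 y2_ge0 h1 h3 h4 h5 h.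
have r1 : 0 <= alpha ^+ 2 * (mu * G * p4 * L * P').
  by rewrite !(addr_ge0, mulr_ge0, exprn_ge0) // op2norm_ge0.
have r2 : 0 <= alpha ^+ 3 * (L ^+ 2 * t * (L * x1 * (3 * p4 + x2) + 2 * x1 * y2)).
  by rewrite !(addr_ge0, mulr_ge0, exprn_ge0) // op2norm_ge0.
have r3 : 0 <= alpha ^+ 3 * (L ^+ 2 * t * Q' * P').
  by rewrite !(addr_ge0, mulr_ge0, exprn_ge0).
have r4 : 0 <= alpha ^+ 3 * (mu * L ^+ 2 * G / 2 * P' * Q').
  by rewrite !(addr_ge0, mulr_ge0, exprn_ge0, invr_ge0).
move: h1 h3 h4 h5 h r1 r2 r3 r4; rewrite !exprS expr0; lra.
Qed.

Lemma spectral_radius_B_lt1 : spectral_radius B < 1.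
Proof.
have diag : forall i, B i i < 1.
  apply: ord3_ind; rewrite -subr_gt0.
  - by apply: lt_le_trans B00_gap; rewrite !mulr_gt0 ?invr_gt0.
  - by apply: lt_le_trans B11_gap; rewrite mulr_gt0.
  - exact: lt_le_trans B22_gap.
have [v [v_gt0 Bv]] := det_shift_gt0_subinvariant B_mx_ge0 diag det_shift_B_gt0.
exact: (spectral_radius_lt ltr01 B_mx_ge0 v_gt0).
Qed.

End StepSize.

(** * Convergence rate *)

Theorem theorem13 (R : realType) (n d nc ng : nat) (alpha mu L : R)
    (e : rel 'I_n) (W1 W2 W3 W4 : 'M[R]_n)
    (fs : 'I_n -> 'cV[R]_d -> R) (xs : 'cV[R]_d)
    (x y : nat -> nat -> 'cV[R]_(n * d)) :
  (0 < n)%N -> (0 < d)%N ->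
  connected_network e ->
  communication_matrix e W1 -> communication_matrix e W2 ->
  communication_matrix e W3 -> communication_matrix e W4 ->
  (forall i z, differentiable (fs i) z) ->
  0 < mu -> strongly_convex mu (average fs) ->
  (forall i, lipschitz_grad L (fs i)) ->
  unique (is_minimizer (average fs)) xs ->
  (1 <= nc)%N -> (1 <= ng)%N ->
  0 < alpha ->
  gradient_tracking nc ng alpha W1 W2 W3 W4 fs x y ->
  irreducible_mx (B_mx d nc ng alpha mu L W1 W2 W3 W4) ->
  beta W1 < 1 -> beta W3 < 1 ->
  (alpha%:E < step_bound d nc ng mu L W1 W2 W3 W4)%E ->
  spectral_radius (B_mx d nc ng alpha mu L W1 W2 W3 W4) < 1 /\
  (forall eps : R, 0 < eps ->
     exists C : R, 0 < C /\
       forall k : nat,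
         l2norm (error_vector xs x y k) <=
         C * (spectral_radius (B_mx d nc ng alpha mu L W1 W2 W3 W4) + eps) ^+ k
           * l2norm (error_vector xs x y 0%N)).
Proof.
move=> n_gt0 d_gt0 _ cW1 cW2 cW3 cW4 fs_diff mu_gt0 f_sc fs_lip [xs_min _] nc_gt0.
case: ng => // T _ alpha_gt0 xy_gt _ beta1_lt1 beta3_lt1 alpha_small.
have L_ge0 : 0 <= L.
  pose i0 := Ordinal n_gt0; pose u : 'cV[R]_d := const_mx 1.
  have u_gt0 : 0 < l2norm u by exact: l2norm_const1_gt0.
  rewrite -(pmulr_lge0 _ u_gt0) -[u]subr0; apply: le_trans (fs_lip i0 u 0).
  exact: l2norm_ge0.
have f_lip := lipschitz_grad_average n_gt0 L_ge0 fs_diff fs_lip.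
have mu_le_L := strong_convexity_le_lipschitz d_gt0 f_sc f_lip.
have ds W := @communication_doubly_stochastic R n e W.
have alphaL_lt1 := step_size_lt1 mu_gt0 mu_le_L alpha_small.
have B_ge0 := B_mx_ge0 n_gt0 mu_gt0 mu_le_L alpha_gt0 alpha_small.
split; first exact: (spectral_radius_B_lt1 n_gt0 mu_gt0 mu_le_L alpha_gt0 (ds _ cW1)).
move=> eps eps_gt0; set rho := spectral_radius _.
have rho_lt : rho < rho + eps by rewrite ltrDl.
have [v [v_gt0 Bv]] := subinvariant_above_spectral_radius B_ge0 rho_lt.
apply: (geometric_decay (M := B_mx d nc T.+1 alpha mu L W1 W2 W3 W4) (v := v)) => //.
- rewrite -(pmulr_lge0 _ (v_gt0 o0)); apply: le_trans (ltW (Bv o0)).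
  by apply: sumr_ge0 => j _; rewrite mulr_ge0 // ltW.
- by move=> i; exact: ltW.
- by move=> k; apply: ord3_ind; rewrite mxE /= l2norm_ge0.
- move=> k i.
  exact: (error_vector_step n_gt0 fs_diff fs_lip mu_gt0 mu_le_L f_sc xs_min alpha_gt0
    alphaL_lt1 (ds _ cW1) (ds _ cW2) (ds _ cW3) (ds _ cW4) xy_gt).
Qed.
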